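(* Let $P$ be a set of $n\geq 3$ points in general position in the plane, and let $G$ be the complete geometric graph with vertex set $P$. Suppose $i(P)\leq 1$. Let $H=H(G)$ be the hypergraph whose vertex set is the edge set $E(G)$ and whose hyperedges are the edge sets of the plane spanning trees of $G$. Then $h_c(H)=\nu(H)-\tau(H)+2$.
   Context: A geometric graph on a set $P$ of points in general position in the plane is a graph with vertex set $P$ whose edges are drawn as straight line segments with ends in $P$; the complete geometric graph on $P$ has all $\binom{|P|}{2}$ such segments as edges. A plane spanning tree of a geometric graph is a spanning tree of it whose edges (as segments) pairwise do not cross (non-self-intersecting). $i(P)$ denotes the number of points of $P$ not lying on the boundary of the convex hull $CH(P)$. For a hypergraph $H$: a $k$-colouring is an assignment of colours to the vertices of $H$ using exactly $k$ colours; a hyperedge is heterochromatic under a colouring if its vertices all receive distinct colours; the heterochromatic number $h_c(H)$ is the smallest integer $k$ such that every $k$-colouring of $H$ has a heterochromatic hyperedge. $\nu(H)$ is the number of vertices of $H$, and $\tau(H)$ is the minimum size of a double transversal of hyperedges, i.e. a set $T$ of vertices such that every hyperedge contains at least two vertices of $T$. *)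

(* Defs.v *)
From mathcomp Require Import all_boot all_order all_algebra.
From mathcomp Require Import finmap.
From mathcomp Require Import all_classical all_reals all_analysis.
Import Order.TTheory GRing.Theory Num.Theory numFieldNormedType.Exports.

Set Implicit Arguments.
Unset Strict Implicit.
Unset Printing Implicit Defensive.

Local Open Scope ring_scope.
Local Open Scope convex_scope.

Record hypergraph := Hypergraph {
  hvertex : finType;
  hedges : {set {set hvertex}} }.

Section Hypergraph.
Variable H : hypergraph.

Definition nu : nat := #|hvertex H|.

Definition heterochromatic k (c : {ffun hvertex H -> 'I_k})
  (e : {set hvertex H}) : Prop := {in e &, injective c}.

(* A k-colouring uses exactly k colours, hence surjectivity onto 'I_k. *)
Definition coloring k (c : {ffun hvertex H -> 'I_k}) : Prop :=
  forall i : 'I_k, exists v, c v = i.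

Definition forces_heterochromatic (k : nat) : Prop :=
  forall c : {ffun hvertex H -> 'I_k}, coloring c ->
    exists2 e, e \in hedges H & heterochromatic c e.

(* The number of colours is positive: a nonempty vertex set has no 0-colouring,
   so k = 0 would satisfy the condition vacuously. *)
Definition hc_pred (k : nat) : bool :=
  (0 < k)%N && `[< forces_heterochromatic k >].

(* There is no colouring with more colours than vertices. *)
Lemma hc_ex : exists k, hc_pred k.
Proof.
exists nu.+1; apply/andP; split=> //; apply/asboolP => c cS; exfalso.
have: (#|'I_nu.+1| <= #|codom c|)%N.
  by apply/subset_leq_card/fintype.subsetP => i _; have [v <-] := cS i; exact: fintype.codom_f.
by rewrite card_ord => /leq_trans/(_ (leq_image_card _ _)); rewrite ltnn.
Qed.

Definition hc : nat := ex_minn hc_ex.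

Definition double_transversal (T : {set hvertex H}) : bool :=
  [forall e in hedges H, 2 <= #|e :&: T|]%N.

(* The default value #|V| bounds the size of every T, so this is the minimum
   size as soon as a double transversal exists. *)
Definition tau : nat :=
  \big[minn/#|hvertex H|]_(T : {set hvertex H} | double_transversal T) #|T|.

End Hypergraph.

Section Plane.
Variable R : realType.

Definition convex_hull (A : set 'rV[R]_2) : set 'rV[R]_2 :=
  smallest (@convex_set R 'rV[R]_2) A.

Definition frontier (T : topologicalType) (A : set T) : set T :=
  (closure A `\` interior A)%classic.

Definition segment (a b : 'rV[R]_2) : set 'rV[R]_2 :=
  range (fun t : {i01 R} =>
    (a : convex_lmodType 'rV[R]_2) <| t |> (b : convex_lmodType 'rV[R]_2)).

Definition line (u v : 'rV[R]_2) : set 'rV[R]_2 :=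
  range (fun t : R => u + t *: v).

Definition general_position (P : {fset 'rV[R]_2}) : Prop :=
  forall a b c, a \in P -> b \in P -> c \in P ->
    a != b -> a != c -> b != c ->
    ~ exists u v : 'rV[R]_2,
        [/\ v != 0, line u v a, line u v b & line u v c].

Definition interior_number (P : {fset 'rV[R]_2}) : nat :=
  #|[set x : P | ~~ `[< frontier (convex_hull [set` P]%classic) (val x) >]]%SET|.

End Plane.

Section GeometricGraph.
Variables (R : realType) (P : {fset 'rV[R]_2}).

Record geometric_graph := GeometricGraph {
  gedges : {set {set P}};
  gedgesP : forall e, e \in gedges -> #|e| = 2%N }.

Lemma complete_edgesP (e : {set P}) :
  e \in [set e : {set P} | #|e| == 2%N]%SET -> #|e| = 2%N.
Proof. by rewrite inE => /eqP. Qed.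

Definition complete_geometric_graph : geometric_graph :=
  GeometricGraph complete_edgesP.

Definition edge_segment (e : {set P}) : set 'rV[R]_2 :=
  [set q | exists x y : P, e = [set x; y]%SET /\ segment (val x) (val y) q]%classic.

(* Segments sharing only a common end do not cross. *)
Definition crossing (e f : {set P}) : Prop :=
  exists q, [/\ edge_segment e q, edge_segment f q
    & ~ exists2 x : P, x \in e :&: f & val x = q].

Definition edge_rel (F : {set {set P}}) : rel P :=
  [rel x y | [set x; y]%SET \in F].

(* The graph with vertex set P and edge set F is connected and acyclic;
   [ucycle] asks for a cycle without repeated vertices. *)
Definition spanning_tree (F : {set {set P}}) : Prop :=
  (forall x y : P, connect (edge_rel F) x y) /\
  (forall s : seq P, (2 < size s)%N -> ~ ucycle (edge_rel F) s).

Definition plane_edges (F : {set {set P}}) : Prop :=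
  forall e f, e \in F -> f \in F -> e != f -> ~ crossing e f.

Definition plane_spanning_tree (F : {set {set P}}) : Prop :=
  spanning_tree F /\ plane_edges F.

Definition tree_hypergraph (G : geometric_graph) : hypergraph :=
  @Hypergraph {e : {set P} | e \in gedges G}
    [set T : {set {e : {set P} | e \in gedges G}}
      | `[< plane_spanning_tree (val @: T)%SET >]]%SET.

End GeometricGraph.

(* Main.v *)
Require Import Defs.
From mathcomp Require Import all_boot all_order all_algebra.
From mathcomp Require Import finmap.
From mathcomp Require Import zify.

Set Implicit Arguments.
Unset Strict Implicit.
Unset Printing Implicit Defensive.

(** Merging the colours on a smallest double transversal gives a colouring with
    nu - tau + 1 colours and no heterochromatic plane tree, so only the upper
    bound is geometric.

    Let n = |P|. If P is in convex position, the hull edges form a double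
    transversal, so tau <= n; if there is one interior point p, then the hull
    edges and two suitably chosen edges at p form one, so tau <= n + 1.

    Given a colouring with nu - tau + 2 colours, select one edge of each colour
    and let D be the set of the tau - 2 unselected edges. If D does not connect
    P, the bichromatic plane spanning tree of a cut of D avoids D, hence is
    heterochromatic. In convex position |D| <= n - 2 and this is always the case.
    Otherwise |D| <= n - 1. Suppose that D cannot be avoided for any choice of
    the selected edges. If a hull edge vw is not in D, then v has degree at most
    1 in D: else D - v does not connect P - v, and vw extends a plane tree of
    P - v. Exchanging an unselected hull edge with the selected edge of its
    colour then bounds the degrees by 2, which forces the component of a hull
    edge of D to consist of hull points. So D contains no hull edge, all hull
    points are leaves, and D is the star of p for every choice of the selected
    edges, which is absurd. *)

(** * Plane trees on an abstract point configuration *)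

Section Orientation.
Local Open Scope set_scope.
Local Open Scope nat_scope.
Variables (V : finType) (o : V -> V -> V -> bool).
(** Segments enter the combinatorial part only through the four crossing properties below; for the
    plane they are derived from determinants. *)
Variable cross : {set V} -> {set V} -> Prop.

Hypothesis oC : forall x y z, o x y z = o y z x.
Hypothesis oN : forall x y z, uniq [:: x; y; z] -> o y x z = ~~ o x y z.
Hypothesis oxx : forall x z, o x x z = false.
(* The consequence for signs of the Grassmann-Pluecker relation
   [xy][zw] + [xw][yz] = [xz][yw], where [xy] = det p x y. *)
Hypothesis gp : forall p x y z w, o p x y -> o p z w -> o p x w -> o p y z ->
  o p x z = o p y w.

Hypothesis crossC : forall e f, cross e f -> cross f e.
Hypothesis crossI : forall a b z w, o a b z -> o b a w ->
  o z w a != o z w b -> cross [set a; b] [set z; w].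
Hypothesis ncross_sep : forall a b u1 u2 v1 v2,
  ~~ o a b u1 -> ~~ o a b u2 -> o a b v1 -> o a b v2 ->
  ~ cross [set u1; u2] [set v1; v2].
Hypothesis ncross_share : forall x y z, uniq [:: x; y; z] ->
  ~ cross [set x; y] [set x; z].

Lemma oxyx x y : o x y x = false. Proof. by rewrite -oC oxx. Qed.
Lemma oxyy x y : o x y y = false. Proof. by rewrite oC oxx. Qed.

Lemma o_neq x y z : o x y z -> [/\ x != y, y != z & x != z].
Proof.
move=> h; split; apply/eqP => e; move: h.
- by rewrite e oxx.
- by rewrite e oxyy.
- by rewrite e oxyx.
Qed.

Lemma o_uniq x y z : o x y z -> uniq [:: x; y; z].
Proof. by move=> /o_neq[xy yz xz]; rewrite /= !inE negb_or xy xz yz. Qed.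

Lemma o_anti x y z : o x y z -> o y x z = false.
Proof. by move=> h; rewrite oN ?h// o_uniq. Qed.

Lemma o_antir x y z : o x y z -> o x z y = false.
Proof. by move=> h; rewrite -oC; exact: o_anti. Qed.

Lemma o_total x y z : x != y -> y != z -> x != z -> ~~ o x y z -> o y x z.
Proof. by move=> xy yz xz h; rewrite oN//= !inE negb_or xy xz yz. Qed.

Lemma o_totalr x y z : x != y -> y != z -> x != z -> ~~ o x y z -> o x z y.
Proof. by move=> xy yz xz h; rewrite -oC; exact: o_total. Qed.

(* A point is extreme when the others are linearly ordered by angle around it,
   that is, when it lies in no triangle of other points. *)
Definition extreme a :=
  [forall b, forall c, forall d, o a b c ==> (o a c d ==> o a b d)].

Lemma extreme_trans a b c d : extreme a -> o a b c -> o a c d -> o a b d.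
Proof. by move=> /forallP/(_ b)/forallP/(_ c)/forallP/(_ d)/implyP h /h/implyP. Qed.

(** A triple violating transitivity surrounds [a]: the three points form a triangle with [a] inside,
    which later places [a] in the interior of the hull. *)
Lemma extremePn a : ~~ extreme a ->
  exists b c d, [/\ o a b c, o a c d & o a d b].
Proof.
move=> /forallPn[b] /forallPn[c] /forallPn[d].
rewrite !negb_imply => /and3P[bc cd bd]; exists b, c, d; split=> //.
have [ab _ _] := o_neq bc; have [ac _ ad] := o_neq cd.
apply: o_totalr => //; apply: contraNneq bd => e.
by move: cd; rewrite -e (o_antir bc).
Qed.

(** If [a] and [b] lay on one side of the line zw, transitivity around [a] or around [b] would put
    [z] and [w] on one side of the line ab. *)
Lemma extreme_cross a b z w : extreme a -> extreme b ->
  o a b z -> o b a w -> cross [set a; b] [set z; w].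
Proof.
move=> ea eb abz baw; apply: crossI => //; apply/negP => /eqP e.
have /o_neq[_ bz az] := abz; have /o_neq[ab aw bw] := baw.
have zw : z != w by apply: contraTneq baw => <-; rewrite o_anti.
case h : (o z w a).
  have : o a b w by apply: (extreme_trans ea abz); rewrite oC.
  by rewrite (o_anti baw).
have {}h : o w z a by apply: o_total; rewrite ?h // eq_sym.
have {}e : o w z b by apply: o_total; rewrite -?e ?(o_anti h) // eq_sym.
have : o b a z by apply: (extreme_trans eb baw); rewrite oC.
by rewrite (o_anti abz).
Qed.

(** * Hull edges *)

Definition hull_edge a b :=
  (a != b) && [forall x, (x != a) ==> ((x != b) ==> o a b x)].

Lemma hull_edgeP a b :
  reflect (a != b /\ forall x, x != a -> x != b -> o a b x) (hull_edge a b).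
Proof.
apply: (iffP andP) => -[ab h]; split=> //.
  by move=> x xa xb; move/forallP/(_ x): h; rewrite xa xb.
by apply/forallP => x; apply/implyP => xa; apply/implyP => xb; exact: h.
Qed.

(** All other points precede [a] in the angular order around [b], so [gp] with [a] as fourth point
    makes this order transitive. *)
Lemma hull_edge_extremer a b : hull_edge a b -> extreme b.
Proof.
move=> /hull_edgeP[ab h].
apply/forallP => c; apply/forallP => d; apply/forallP => e.
apply/implyP => cd; apply/implyP => de.
have oba x : x != a -> x != b -> o b x a by move=> xa xb; rewrite -oC; exact: h.
have [bc _ _] := o_neq cd; have [bd _ be] := o_neq de.
rewrite eq_sym in bc; rewrite eq_sym in bd; rewrite eq_sym in be.
have [da|da] := eqVneq d a.
  have ea : e != a by apply: contraTneq de => ->; rewrite da oxyy.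
  by move: de; rewrite da (o_antir (oba e ea be)).
have [ea|ea] := eqVneq e a.
  have ca : c != a by apply: contraTneq de => ca; rewrite ea -ca (o_antir cd).
  by rewrite ea oba.
have [ca|ca] := eqVneq c a.
  by move: cd; rewrite ca (o_antir (oba d da bd)).
by rewrite (gp cd (oba e ea be) (oba c ca bc) de) oba.
Qed.

Lemma hull_edge_extremel a b : hull_edge a b -> extreme a.
Proof.
move=> /hull_edgeP[ab h].
apply/forallP => c; apply/forallP => d; apply/forallP => e.
apply/implyP => cd; apply/implyP => de.
have [ac _ ad] := o_neq cd; have [_ _ ae] := o_neq de.
rewrite eq_sym in ac; rewrite eq_sym in ad; rewrite eq_sym in ae.
have [db|db] := eqVneq d b.
  have cb : c != b by apply: contraTneq cd => ->; rewrite db oxyy.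
  by move: cd; rewrite db (o_antir (h c ac cb)).
have [eb|eb] := eqVneq e b; first by move: de; rewrite eb (o_antir (h d ad db)).
have [->|cb] := eqVneq c b; first exact: h.
by rewrite -(gp (h c ac cb) de (h e ae eb) cd) h.
Qed.

Lemma hull_edge_uniq a b c : hull_edge a b -> hull_edge a c -> b = c.
Proof.
move=> /hull_edgeP[ab hb] /hull_edgeP[ac hc]; apply/eqP/negPn/negP => bc.
have abc : o a b c by apply: hb; rewrite // eq_sym.
have : o a c b by apply: hc; rewrite // eq_sym.
by rewrite (o_antir abc).
Qed.

Definition next a := odflt a [pick b | hull_edge a b].

Lemma nextE a b : hull_edge a b -> next a = b.
Proof.
rewrite /next; case: pickP => [c hc hb|/(_ b)->//].
exact: hull_edge_uniq hc hb.
Qed.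

(** An image of the extreme points, so that their number bounds its size at once. An extreme point
    whose [next] is the default adds only a singleton, which is no edge. *)
Definition hull_edges := [set [set a; next a] | a in [pred a | extreme a]].

Lemma card_hull_edges : #|hull_edges| <= #|[pred a | extreme a]|.
Proof. exact: leq_imset_card. Qed.

Lemma mem_hull_edges a b : extreme a -> hull_edge a b -> [set a; b] \in hull_edges.
Proof. by move=> ea ab; apply/imsetP; exists a; rewrite ?inE// (nextE ab). Qed.

(** Connectivity in the form of cuts: the arguments below choose a vertex set and take an edge
    leaving it. *)
Definition connected_edges (Q : {set {set V}}) := forall A : {set V},
  A != set0 -> A != setT -> exists x y, [/\ x \in A, y \notin A & [set x; y] \in Q].

Definition noncrossing (Q : {set {set V}}) := forall e f,
  e \in Q -> f \in Q -> e != f -> ~ cross e f.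

(** * Hull edges beyond a chord, and the double transversal in convex position *)

Section Transversal.
Variable Q : {set {set V}}.
Hypothesis Qconn : connected_edges Q.
Hypothesis Qplane : noncrossing Q.

Lemma plane_side a b z w : extreme a -> extreme b -> [set a; b] \in Q ->
  [set z; w] \in Q -> o a b z -> ~~ o b a w.
Proof.
move=> ea eb abQ zwQ abz; apply/negP => baw.
apply: (Qplane abQ zwQ); last exact: extreme_cross.
have [_ bz az] := o_neq abz.
apply/eqP => /setP/(_ z); rewrite !inE eqxx.
by rewrite eq_sym (negPf az) eq_sym (negPf bz).
Qed.

Definition left_closed a b x := [|| x == a, x == b | o a b x].

(** Induction on the number of points strictly left of ab. Some edge leaves this set, and planarity
    forces it to end at [a] or [b]; as a new chord it has fewer points on its left. When none is
    left, the chord is a hull edge, read backwards. *)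
Lemma hull_edge_beyond a b : extreme a -> extreme b -> a != b ->
  [set a; b] \in Q -> (forall x, o a b x -> extreme x) ->
  exists c d, [/\ [set c; d] \in Q, hull_edge d c, extreme d,
    left_closed a b c & left_closed a b d].
Proof.
have [n] := ubnP #|[set x | o a b x]|; elim: n a b => // n IH a b.
rewrite ltnS => le_n ea eb ab abQ ext.
have [[z abz]|none] := boolp.pselect (exists z, o a b z); last first.
  exists a, b; split; rewrite /left_closed ?eqxx ?orbT//.
  apply/hull_edgeP; split; first by rewrite eq_sym.
  move=> x xb xa; apply: o_total => //; rewrite 1?eq_sym//.
  by apply/negP => h; apply: none; exists x.
have [x [y [abx nby xyQ]]] : exists x y,
    [/\ x \in [set x | o a b x], y \notin [set x | o a b x] & [set x; y] \in Q].
  apply: Qconn; first by apply/set0Pn; exists z; rewrite inE.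
  by apply/negP => /eqP/setP/(_ a); rewrite !inE oxyx.
move: abx nby; rewrite !inE => abx nby.
have shrink c d : [set c; d] \in Q -> extreme c -> extreme d -> c != d ->
    (forall u, o c d u -> o a b u) -> ~~ o c d x -> left_closed a b c ->
    left_closed a b d ->
    exists c d, [/\ [set c; d] \in Q, hull_edge d c, extreme d,
    left_closed a b c & left_closed a b d].
  move=> cdQ ec ed cd sub ncdx lc ld.
  have lt_n : #|[set u | o c d u]| < n.
    apply: leq_trans le_n; apply: proper_card; apply/properP; split.
      by apply/subsetP => u; rewrite !inE; exact: sub.
    by exists x; rewrite inE.
  have [|u [v [uvQ uv ev lu lv]]] := IH c d lt_n ec ed cd cdQ.
    by move=> u /sub/ext.
  exists u, v; split=> //.
    by move: lu => /or3P[/eqP->|/eqP->|/sub h]//; rewrite /left_closed h !orbT.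
  by move: lv => /or3P[/eqP->|/eqP->|/sub h]//; rewrite /left_closed h !orbT.
have [_ bx ax] := o_neq abx.
have [ya|ya] := eqVneq y a.
  apply: (shrink a x); rewrite ?oxyy /left_closed ?eqxx ?abx ?orbT//.
  - by rewrite setUC -ya.
  - exact: ext.
  - by move=> u; exact: extreme_trans.
have [yb|yb] := eqVneq y b.
  apply: (shrink x b); rewrite ?oxyx /left_closed ?eqxx ?abx ?orbT//.
  - by rewrite -yb.
  - exact: ext.
  - by rewrite eq_sym.
  - move=> u xbu; rewrite oC; apply: (extreme_trans eb) (_ : o b u x) _.
      by rewrite -oC.
    by rewrite -oC.
have := plane_side ea eb abQ xyQ abx.
by rewrite o_total// 1?eq_sym.
Qed.

Lemma left_closed_both a b x : left_closed a b x -> left_closed b a x ->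
  (x == a) || (x == b).
Proof.
rewrite /left_closed => /or3P[->//|->|abx]; rewrite ?orbT//.
by rewrite (o_anti abx) orbF orbC.
Qed.

Lemma mem_hull_edges_swap c d : extreme d -> hull_edge d c ->
  [set c; d] \in hull_edges.
Proof. by move=> ed dc; rewrite setUC mem_hull_edges. Qed.

(** A chord with points on both sides has a hull edge of [Q] beyond each side; a common one would be
    ab itself, so they differ. Without such a chord all edges of [Q] are hull edges, and more than
    two points need two of them. *)
Lemma hull_edges_double_transversal : (forall a, extreme a) -> 2 < #|V| ->
  (forall e, e \in Q -> #|e| = 2) -> 2 <= #|Q :&: hull_edges|.
Proof.
move=> ext V2 Q2; apply/card_gt1P.
have [[a [b [z [w [abQ abz baw]]]]]|all_hull] := boolp.pselect (exists a b z w,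
    [/\ [set a; b] \in Q, o a b z & o b a w]).
  have [ab _ _] := o_neq abz; have ba : b != a by rewrite eq_sym.
  have [c [d [cdQ dc ed lc ld]]] :=
    hull_edge_beyond (ext a) (ext b) ab abQ (fun x _ => ext x).
  have baQ : [set b; a] \in Q by rewrite setUC.
  have [c' [d' [cdQ' dc' ed' lc' ld']]] :=
    hull_edge_beyond (ext b) (ext a) ba baQ (fun x _ => ext x).
  exists [set c; d], [set c'; d'].
  rewrite !inE cdQ cdQ' !mem_hull_edges_swap//; split=> //.
  apply/eqP => /setP cdE.
  have incl x : x \in [set c; d] -> (x == a) || (x == b).
    move=> xcd; apply: left_closed_both.
      by move: xcd; rewrite !inE => /orP[]/eqP->.
    by move: xcd; rewrite cdE !inE => /orP[]/eqP->.
  have [dnc h] := hull_edgeP _ _ dc.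
  have := incl c; have := incl d; rewrite !inE !eqxx orbT => /(_ isT) dab /(_ isT).
  have [_ bz az] := o_neq abz; have [_ aw bw] := o_neq baw.
  move: dab dnc h => /orP[]/eqP-> dnc h /orP[]/eqP cE; move: dnc h; rewrite cE ?eqxx//.
    by move=> _ /(_ w); rewrite eq_sym aw eq_sym bw (o_anti baw) => /(_ isT isT).
  by move=> _ /(_ z); rewrite eq_sym bz eq_sym az (o_anti abz) => /(_ isT isT).
have Qhull e : e \in Q -> e \in Q :&: hull_edges.
  move=> eQ; have /eqP/cards2P[a [b [ab eE]]] := Q2 e eQ; rewrite inE eQ.
  have [[z abz]|none] := boolp.pselect (exists z, o a b z).
    rewrite eE mem_hull_edges//; apply/hull_edgeP; split=> // x xa xb.
    apply: o_total => //; rewrite 1?eq_sym//; apply/negP => bax; apply: all_hull.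
    by exists a, b, z, x; rewrite -eE.
  rewrite eE setUC mem_hull_edges//; apply/hull_edgeP; split; first by rewrite eq_sym.
  move=> x xb xa; apply: o_total => //; rewrite 1?eq_sym//; apply/negP => abx.
  by apply: none; exists x.
(* Applied to a single vertex and then to the edge found there, this yields two distinct edges. *)
have proper_edge (A : {set V}) : 0 < #|A| <= 2 -> exists x y,
    [/\ x \in A, y \notin A & [set x; y] \in Q].
  move=> /andP[A0 A2]; apply: Qconn; first by rewrite -card_gt0.
  by apply: contraTneq A2 => ->; rewrite cardsT -ltnNge.
have [v _] : exists v : V, v \in V by apply/card_gt0P; rewrite (ltn_trans _ V2).
have [x [y [_ _ xyQ]]] := proper_edge [set v] ltac:(by rewrite cards1).
have [z [w [zxy wxy zwQ]]] := proper_edge [set x; y] ltac:(by rewrite cards2; case: eqVneq).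
exists [set x; y], [set z; w]; split; try exact: Qhull.
by apply: contraNneq wxy => ->; rewrite !inE eqxx orbT.
Qed.
End Transversal.

(** * The double transversal with one interior point *)

Section InteriorPoint.
Variable p : V.
Hypothesis ext : forall a, a != p -> extreme a.

(** If [x] were in the angle apb but not beyond ab, it would lie in the triangle pab; if it were
    beyond ab but outside the angle, [a] or [b] would lie in a triangle. These points are extreme,
    so neither happens. *)
Lemma cone_leftE a b x : o p a b -> x != p -> o b a x = o p a x && o p x b.
Proof.
move=> pab xp; have [pa ab pb] := o_neq pab.
have ea : extreme a by rewrite ext // eq_sym.
have eb : extreme b by rewrite ext // eq_sym.
apply/idP/andP => [bax|[pax pxb]].
  have [_ ax bx] := o_neq bax.
  have px : p != x by rewrite eq_sym.
  split; apply: contraTT bax => h.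
    have apx := o_total pa ax px h.
    by rewrite (o_anti (extreme_trans ea _ apx))// -oC.
  have pbx : o p b x by apply: o_totalr; rewrite // eq_sym.
  have bpa : o b p a by rewrite oC.
  by rewrite (o_antir (extreme_trans eb _ bpa))// -oC.
have [_ xb _] := o_neq pxb; have [_ ax _] := o_neq pax.
have ex := ext xp; apply: o_total; rewrite // 1?eq_sym //; apply/negP => abx.
have : o x p b by apply: (@extreme_trans _ _ a); rewrite // oC.
by rewrite (@o_antir x b p)// -oC.
Qed.

(* When [o p a b], the cone consists of a, b and the points that the chord ab
   separates from p. *)
Definition cone a b := [set x | [|| x == a, x == b | o p a x && o p x b]].

Lemma cone_apex a b : o p a b -> p \notin cone a b.
Proof.
by move=> /o_neq[pa _ pb]; rewrite inE (negPf pa) (negPf pb) oxyx.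
Qed.

Lemma cone_left_closed a b x : o p a b -> x != p ->
  (x \in cone a b) = left_closed b a x.
Proof.
move=> pab xp; rewrite inE /left_closed (cone_leftE pab xp).
by case: eqVneq => //; rewrite orbT.
Qed.

Lemma left_closed_apex a b : o p a b -> ~~ left_closed b a p.
Proof.
move=> pab; have [pa _ pb] := o_neq pab.
by rewrite /left_closed negb_or pb negb_or pa o_anti// -oC.
Qed.

(** A cone is an angular interval at [p] of less than a half-turn. Transitivity around [p] does not
    follow from [ext], so [gp] takes its place. *)
Lemma cone_sub a b s t : o p a b -> o p s t -> s \in cone a b -> t \in cone a b ->
  cone s t \subset cone a b.
Proof.
move=> pab pst; rewrite !inE => sab tab.
(* Since [s] precedes [t] around [p], [s] is not [b]; likewise [t] is not [a] below. *)
have {}sab : (s == a) || o p a s && o p s b.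
  move: sab => /or3P[->//|/eqP sb|->]; rewrite ?orbT//; subst s.
  move: tab => /or3P[/eqP ta|/eqP tb|/andP[_ ptb]].
  - by move: pst; rewrite ta (o_antir pab).
  - by move: pst; rewrite tb oxyy.
  - by move: pst; rewrite (o_antir ptb).
have {}tab : (t == b) || o p a t && o p t b.
  move: tab => /or3P[/eqP ta|->//|->]; rewrite ?orbT//; subst t.
  move: sab => /orP[/eqP sa|/andP[pas _]].
  - by move: pst; rewrite sa oxyy.
  - by move: pst; rewrite (o_antir pas).
have pat : o p a t by move: tab => /orP[/eqP->//|/andP[]].
have psb : o p s b by move: sab => /orP[/eqP->//|/andP[]].
apply/subsetP => x; rewrite !inE => /or3P[/eqP->|/eqP->|/andP[psx pxt]].
- by move: sab => /orP[->//|->]; rewrite !orbT.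
- by move: tab => /orP[->//|->]; rewrite !orbT.
apply/or3P/Or33/andP; split.
  move: sab => /orP[/eqP<-//|/andP[pas _]].
  by rewrite (gp pas pxt pat psx).
move: tab => /orP[/eqP<-//|/andP[_ ptb]].
by rewrite -(gp psx ptb psb pxt).
Qed.

(* For such s and t, a chord of a plane tree whose closed side away from p
   contains both s and t is st itself. *)
Definition antipodal s t := o p s t /\
  forall a b, o p a b -> s \in cone a b -> t \in cone a b -> a = s /\ b = t.

(** Choose a pair with the largest cone. By [cone_sub] any cone containing both points equals
    theirs, and a cone determines its two ends. *)
Lemma antipodal_exists : ~~ extreme p -> exists s t, antipodal s t.
Proof.
move=> /extremePn[u [v [_ [puv _ _]]]].
have [[s t] /= pst max] := @arg_maxnP _ (u, v) [pred w | o p w.1 w.2]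
  (fun w => #|cone w.1 w.2|) puv.
exists s, t; split=> // a b pab sab tab.
have coneE : cone s t = cone a b.
  apply/eqP; rewrite eqEcard cone_sub//=; exact: (max (a, b)).
move: (sab) (tab) => sab' tab'; rewrite !inE in sab' tab'.
have : a \in cone s t by rewrite coneE inE eqxx.
have : b \in cone s t by rewrite coneE inE eqxx orbT.
rewrite !inE => bst ast; split; apply/eqP.
  apply: contraT => nas.
  have psa : o p s a.
    by move: ast; rewrite (negPf nas) /= => /orP[/eqP->|/andP[]].
  move: sab'; rewrite eq_sym (negPf nas) /= => /orP[/eqP sb|/andP[pas _]].
    by move: psa; rewrite sb (o_antir pab).
  by move: psa; rewrite (o_antir pas).
apply: contraT => nbt.
have pbt : o p b t.
  by move: bst; rewrite (negPf nbt) /= => /orP[/eqP->|/andP[]].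
move: tab'; rewrite [t == b]eq_sym (negPf nbt) /= => /orP[/eqP ta|/andP[_ ptb]].
  by move: pbt; rewrite ta (o_antir pab).
by move: pbt; rewrite (o_antir ptb).
Qed.

Definition pierced_hull_edges s t := hull_edges :|: [set [set p; s]; [set p; t]].

Lemma card_pierced_hull_edges s t : ~~ extreme p ->
  #|pierced_hull_edges s t| <= #|V| + 1.
Proof.
move=> np; apply: leq_trans (leq_card_setU _ _) _.
apply: leq_trans (leq_add card_hull_edges (_ : _ <= 2)) _.
  by rewrite cards2; case: eqVneq.
rewrite -(cardC [pred a | extreme a]) -addnA leq_add2l addn1 ltnS.
by apply/card_gt0P; exists p; rewrite !inE.
Qed.

(* Take a chord ab of Q with the largest cone: there is a hull edge of Q beyond ab.
   Another chord leaving the cone of ab gives a second hull edge. Otherwise all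
   points outside the cone are joined to p only, and so is a or b; one of these
   edges at p is ps or pt. *)
Lemma pierced_hull_edges_double_transversal s t (Q : {set {set V}}) :
  antipodal s t -> connected_edges Q -> noncrossing Q ->
  2 <= #|Q :&: pierced_hull_edges s t|.
Proof.
move=> [pst stP] Qconn Qplane; apply/card_gt1P.
have [ps st pt] := o_neq pst.
have extl a b x : o p a b -> o b a x -> extreme x.
  move=> pab bax; apply: ext; apply: contraTneq bax => ->.
  by rewrite o_anti// -oC.
have spoke x : x != p -> exists2 y, [set x; y] \in Q & (y = p) \/ (o p x y || o p y x).
  move=> xp; have [||u [y [/set1P-> yx xyQ]]] := Qconn [set x].
  - by rewrite -card_gt0 cards1.
  - by apply/negP => /eqP/setP/(_ p); rewrite !inE eq_sym (negPf xp).
  exists y => //; have [|yp] := eqVneq y p; [by left|right].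
  case: (boolP (o p x y)) => //= h; apply: o_totalr; rewrite // 1?eq_sym//.
  by move: yx; rewrite inE.
have [[[a b] /= /andP[abQ pab] max]|none] :
    (exists2 w : V * V, ([set w.1; w.2] \in Q) && o p w.1 w.2 &
      forall w', ([set w'.1; w'.2] \in Q) && o p w'.1 w'.2 ->
      #|cone w'.1 w'.2| <= #|cone w.1 w.2|) \/
    (forall a b, [set a; b] \in Q -> ~~ o p a b).
- have [/existsP[w wQ]|] := boolP [exists w : V * V,
      ([set w.1; w.2] \in Q) && o p w.1 w.2].
    left; have [w' w'Q max] := @arg_maxnP _ w
      [pred w | ([set w.1; w.2] \in Q) && o p w.1 w.2] (fun w => #|cone w.1 w.2|) wQ.
    by exists w'.
  rewrite negb_exists => /forallP none; right => a b abQ.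
  by have := none (a, b); rewrite /= abQ.
- have [pa ab pb] := o_neq pab.
  have ea : extreme a by rewrite ext // eq_sym.
  have eb : extreme b by rewrite ext // eq_sym.
  have ba : b != a by rewrite eq_sym.
  have baQ : [set b; a] \in Q by rewrite setUC.
  have [u [v [uvQ vu ev lu lv]]] :=
    hull_edge_beyond Qconn Qplane eb ea ba baQ (fun x => @extl a b x pab).
  have inc c d x : o p c d -> left_closed d c x -> x \in cone c d.
    move=> pcd lx; rewrite cone_left_closed//.
    by apply: contraTneq lx => ->; exact: left_closed_apex.
  have {lu}uC := inc _ _ _ pab lu; have {lv}vC := inc _ _ _ pab lv.
  have uvT : [set u; v] \in Q :&: pierced_hull_edges s t.
    by rewrite !inE uvQ mem_hull_edges_swap.
  have uvp : p \notin [set u; v].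
    apply/negP; rewrite !inE => /orP[]/eqP e; move: (cone_apex pab).
      by rewrite e uC.
    by rewrite e vC.
  have spokeT x : [set x; p] \in Q -> (x == s) || (x == t) ->
      exists x0 y, [/\ x0 \in Q :&: pierced_hull_edges s t,
        y \in Q :&: pierced_hull_edges s t & x0 != y].
    move=> xpQ xst; exists [set u; v], [set x; p]; split=> //; last first.
      by apply: contraNneq uvp => ->; rewrite !inE eqxx orbT.
    rewrite inE xpQ inE [_ \in [set _; _]]inE !inE [ [set x; p] ]setUC.
    by move: xst => /orP[]/eqP->; rewrite eqxx ?orbT.
  have [[c [d [cdQ pcd cdab]]]|all_in] :
      (exists c d, [/\ [set c; d] \in Q, o p c d &
        ~~ ((c \in cone a b) && (d \in cone a b))]) \/
      (forall c d, [set c; d] \in Q -> o p c d ->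
        (c \in cone a b) && (d \in cone a b)).
  - have [/existsP[[c d] /= /and3P[cdQ pcd cdab]]|] := boolP [exists w : V * V,
        [&& [set w.1; w.2] \in Q, o p w.1 w.2 &
          ~~ ((w.1 \in cone a b) && (w.2 \in cone a b))]].
      by left; exists c, d.
    rewrite negb_exists => /forallP none; right => c d cdQ pcd.
    by have := none (c, d); rewrite /= cdQ pcd /= negbK.
  + have [pc cd pd] := o_neq pcd.
    have ec : extreme c by rewrite ext // eq_sym.
    have ed : extreme d by rewrite ext // eq_sym.
    have dc : d != c by rewrite eq_sym.
    have dcQ : [set d; c] \in Q by rewrite setUC.
    have [u' [v' [uvQ' vu' ev' lu' lv']]] :=
      hull_edge_beyond Qconn Qplane ed ec dc dcQ (fun x => @extl c d x pcd).
    have {lu'}uC' := inc _ _ _ pcd lu'; have {lv'}vC' := inc _ _ _ pcd lv'.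
    exists [set u; v], [set u'; v']; split=> //.
      by rewrite !inE uvQ' mem_hull_edges_swap.
    apply/eqP => /setP uvE.
    (* By the maximality of the cone of ab, neither cone contains the other. *)
    have abcd : ~~ ((a \in cone c d) && (b \in cone c d)).
      apply: contraNN cdab => /andP[aC bC].
      suff -> : cone a b = cone c d by rewrite !inE !eqxx !orbT.
      apply/eqP; rewrite eqEcard cone_sub//=; apply: (max (c, d)).
      by rewrite /= cdQ.
    (* An end strictly inside the other cone lies beyond the other chord, and planarity then keeps
       the second end in that cone too. *)
    have outside x1 x2 y1 y2 : o p x1 x2 -> o p y1 y2 -> [set x1; x2] \in Q ->
        [set y1; y2] \in Q -> ~~ ((y1 \in cone x1 x2) && (y2 \in cone x1 x2)) ->
        (o p x1 y1 && o p y1 x2 = false) * (o p x1 y2 && o p y2 x2 = false).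
      move=> px12 py12 xQ yQ nin.
      have [px1 x12 px2] := o_neq px12; have [py1 _ py2] := o_neq py12.
      have ex1 : extreme x1 by rewrite ext // eq_sym.
      have ex2 : extreme x2 by rewrite ext // eq_sym.
      have xQ' : [set x2; x1] \in Q by rewrite setUC.
      have side y y' : p != y -> p != y' -> [set y; y'] \in Q ->
          o p x1 y && o p y x2 -> (y \in cone x1 x2) && (y' \in cone x1 x2).
        move=> py py' yyQ /andP[h1 h2]; rewrite inE h1 h2 !orbT /=.
        have h : o x2 x1 y by rewrite cone_leftE ?h1// eq_sym.
        rewrite cone_left_closed 1?eq_sym//; apply: contraT.
        rewrite /left_closed !negb_or => /and3P[n2 n1 n21].
        have := plane_side Qplane ex2 ex1 xQ' yyQ h.
        by rewrite o_total// eq_sym.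
      split; apply: contraNF nin => h; first exact: side yQ h.
      by rewrite andbC; apply: side h; rewrite // setUC.
    have [cab dab] := outside a b c d pab pcd abQ cdQ cdab.
    have [acd bcd] := outside c d a b pcd pab cdQ abQ abcd.
    (* If the open cones met, the one that starts first around [p] would strictly contain the first
       end of the other; for [c] equal to [a], the second ends are compared. *)
    have common x : (o p a x && o p x b) && (o p c x && o p x d) = false.
      apply/negP => /andP[/andP[ax xb] /andP[cx xd]].
      have [ca|ca] := eqVneq c a.
        subst c; move: bcd dab; rewrite pab pcd /=.
        have [bd|bd] := eqVneq b d.
          by move: cdab; rewrite !inE !eqxx bd eqxx orbT.
        case: (boolP (o p b d)) => //= h _.
        by rewrite o_totalr.
      case: (boolP (o p a c)) => [ac|nac].
        by move: cab; rewrite ac -(gp ac xb pab cx) ax.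
      have ca' : o p c a by rewrite o_totalr // eq_sym.
      by move: acd; rewrite ca' -(gp ca' xd pcd ax) cx.
    (* A hull edge beyond both chords has its ends in both cones, hence among the ends of both
       chords, so the chords would coincide. *)
    have both x : x \in [set u; v] -> ((x == a) || (x == b)) && ((x == c) || (x == d)).
      move=> xuv.
      have : x \in cone a b by move: xuv; rewrite inE => /orP[]/set1P->.
      have : x \in cone c d by move: xuv; rewrite uvE inE => /orP[]/set1P->.
      rewrite !inE !orbA => /orP[xcd|xcd] /orP[xab|xab]; rewrite ?xcd ?xab//.
      - by move: xcd xab => /orP[]/eqP->; rewrite ?cab ?dab.
      - by move: xab xcd => /orP[]/eqP->; rewrite ?acd ?bcd.
      - by move: (common x); rewrite xab xcd.
    have [uv _] := hull_edgeP _ _ vu.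
    have /andP[uab ucd] : ((u == a) || (u == b)) && ((u == c) || (u == d)).
      by apply: both; rewrite !inE eqxx.
    have /andP[vab vcd] : ((v == a) || (v == b)) && ((v == c) || (v == d)).
      by apply: both; rewrite !inE eqxx orbT.
    move/negP: cdab; apply; rewrite !inE.
    by move: uab ucd vab vcd uv cd ab; do 4!(move=> /orP[]/eqP ?); subst;
      rewrite ?eqxx ?orbT.
  (* Now every chord stays in the cone, so an edge at a point outside it goes to [p]. *)
  have [sab|sab] := boolP (s \in cone a b); last first.
    have [|y syQ [ysp|/orP[psy|pys]]] := spoke s; first by rewrite eq_sym.
    - by apply: (spokeT s); rewrite ?eqxx// -ysp.
    - by have := all_in s y syQ psy; rewrite (negPf sab).
    - by have := all_in y s; rewrite setUC (negPf sab) andbF => /(_ syQ pys).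
  have [tab|tab] := boolP (t \in cone a b); last first.
    have [|y tyQ [ytp|/orP[pty|pyt]]] := spoke t; first by rewrite eq_sym.
    - by apply: (spokeT t); rewrite ?eqxx ?orbT// -ytp.
    - by have := all_in t y tyQ pty; rewrite (negPf tab).
    - by have := all_in y t; rewrite setUC (negPf tab) andbF => /(_ tyQ pyt).
  have [aE bE] := stP a b pab sab tab; subst s t.
  (* Here ab is st. An edge leaving the cone goes to [p], and by planarity it starts at [a] or
     [b]. *)
  have [||x [y [xC yC xyQ]]] := Qconn (cone a b).
  - by apply/set0Pn; exists a.
  - by apply/negP => /eqP/setP/(_ p); rewrite (negPf (cone_apex pab)) inE.
  have xp : x != p by apply: contraTneq xC => ->; exact: cone_apex.
  have [yp|yp] := eqVneq y p.
    apply: (spokeT x); first by rewrite -yp.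
    move: (xC); rewrite inE orbA => /orP[//|]; rewrite -(cone_leftE pab xp) => bax.
    by have := plane_side Qplane eb ea baQ xyQ bax; rewrite yp -oC pab.
  have xy : x != y by apply: contraTneq xC => ->.
  case: (boolP (o p x y)) => [pxy|pyx].
    by have := all_in x y xyQ pxy; rewrite (negPf yC) andbF.
  have pyx' : o p y x by rewrite o_totalr // eq_sym.
  by have := all_in y x; rewrite setUC (negPf yC) xyQ => /(_ isT pyx').
(* Without chords, [Q] contains the whole star of [p]. *)
have star x : x != p -> [set p; x] \in Q.
  move=> xp; have [y xyQ [yp|/orP[pxy|pyx]]] := spoke x xp.
  - by rewrite setUC -yp.
  - by have := none x y xyQ; rewrite pxy.
  - by have := none y x; rewrite setUC pyx => /(_ xyQ).
exists [set p; s], [set p; t]; rewrite !inE !eqxx !orbT !andbT !star// 1?eq_sym//.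
split=> //; apply/eqP => /setP/(_ s); rewrite !inE eqxx orbT.
by rewrite eq_sym (negPf ps) (negPf st).
Qed.
End InteriorPoint.

(** * Plane trees avoiding a set of edges *)

Lemma transitive_max (r : rel V) (B : {set V}) : B != set0 ->
  (forall x, r x x = false) ->
  (forall x y z, r x y -> r y z -> r x z) ->
  {in B &, forall x y, x != y -> r x y || r y x} ->
  exists2 b, b \in B & {in B, forall x, x != b -> r x b}.
Proof.
move=> /set0Pn[b0 b0B] irr trans tot.
have [b bB max] := @arg_maxnP _ b0 (mem B) (fun b => #|[set x in B | r x b]|) b0B.
exists b => // x xB xb; have /orP[//|bx] := tot x b xB bB xb.
have /= := max x xB; rewrite leqNgt => /negP[]; apply: proper_card; apply/properP.
split; last by exists b; rewrite inE ?irr ?andbF// bx andbT; exact: bB.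
apply/subsetP => y; rewrite !inE => /andP[-> yb]; exact: trans yb bx.
Qed.

(* The tree is given by its root r and the parent function par; the height h
   decreases towards the root, which excludes cycles. *)
Definition plane_tree_on (S : {set V}) (D : {set {set V}}) r (par : V -> V)
    (h : V -> nat) :=
  [/\ r \in S,
    forall x, x \in S -> x != r ->
      [/\ par x \in S, h (par x) < h x & [set x; par x] \notin D] &
    forall x y, x \in S -> x != r -> y \in S -> y != r ->
      [set x; par x] != [set y; par y] -> ~ cross [set x; par x] [set y; par y]].

Definition avoidable S D := exists r par h, plane_tree_on S D r par h.

Lemma ncross_sepC a b u1 u2 v1 v2 :
  ~~ o a b u1 -> ~~ o a b u2 -> o a b v1 -> o a b v2 ->
  ~ cross [set v1; v2] [set u1; u2].
Proof. by move=> h1 h2 h3 h4 /crossC; exact: ncross_sep h1 h2 h3 h4. Qed.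

Lemma ncross_common x y z : x != y -> x != z -> [set x; y] != [set x; z] ->
  ~ cross [set x; y] [set x; z].
Proof.
move=> xy xz ne; apply: ncross_share; rewrite /= !inE negb_or xy xz /= andbT.
by apply: contraNneq ne => ->.
Qed.

(* Join a to all points of S :\: A, and every other point x of A to the last point
   of S :\: A before x in the angular order around a, or to the first point of
   S :\: A if there is none before x. *)
Lemma bichromatic_tree (S A : {set V}) (D : {set {set V}}) a : extreme a ->
  a \in A -> A \subset S -> A != S ->
  {in A & S :\: A, forall x y, [set x; y] \notin D} -> avoidable S D.
Proof.
move=> ea aA AS AnS ncD; pose B := S :\: A.
have B0 : B != set0.
  apply: contraNneq AnS => B0; rewrite eqEsubset AS /=.
  by rewrite -setD_eq0 -/B B0.
have aS : a \in S := subsetP AS a aA.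
have naB b : b \in B -> b != a.
  by rewrite inE => /andP[h _]; apply: contraNneq h => ->.
have tot x y : x != a -> y != a -> x != y -> o a x y || o a y x.
  move=> xa ya xy; case: (boolP (o a x y)) => //= h.
  by apply: o_totalr; rewrite // eq_sym.
have max (C : {set V}) : C \subset B -> C != set0 ->
    exists2 b, b \in C & {in C, forall x, x != b -> o a x b}.
  move=> CB C0; apply: transitive_max => // [x|x y z|x y xC yC].
  - exact: oxyy.
  - exact: extreme_trans.
  - by apply: tot; apply: naB; exact: (subsetP CB).
have [m mB mmin] : exists2 b, b \in B & {in B, forall x, x != b -> o a b x}.
  apply: (@transitive_max (fun x y => o a y x)) => // [x|x y z|x y xC yC xy].
  - exact: oxyy.
  - by move=> h1 h2; exact: extreme_trans h2 h1.
  - by apply: tot; rewrite ?naB// eq_sym.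
(* Specification of the parent [y] of [x]; the last alternative is for points of [A] that precede
   all of [B], whose first point is [m]. *)
pose P x y := (x \in B -> y = a) /\ (x \in A -> x != a ->
  y \in B /\ ((o a y x /\ {in B, forall b, o a b x -> b != y -> o a b y})
   \/ (y = m /\ {in B, forall b, o a x b}))).
have [par parP] : exists par : V -> V, forall x, P x (par x).
  apply: (@fin_all_exists _ (fun _ => V) (fun x y => P x y)) => x.
  have [xB|xB] := boolP (x \in B).
    exists a; split=> // xA; by move: xB; rewrite inE xA.
  have [/andP[xA xa]|nx] := boolP ((x \in A) && (x != a)); last first.
    by exists a; split=> // xA xa; rewrite xA xa in nx.
  have [C0|C0] := eqVneq [set b in B | o a b x] set0.
    exists m; split=> [|_ _]; first by rewrite (negPf xB).
    split=> //; right; split=> // b bB.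
    have xb : x != b by apply: contraNneq xB => ->.
    have /orP[//|bx] := tot x b xa (naB b bB) xb.
    by move/setP/(_ b): C0; rewrite !inE -[_ && (_ \in S)]in_setD -/B bB bx.
  have [|b bC bmax] := max [set b in B | o a b x] _ C0.
    by apply/subsetP => y; rewrite inE => /andP[].
  move: bC; rewrite inE => /andP[bB bx].
  exists b; split=> [|_ _]; first by rewrite (negPf xB).
  split=> //; left; split=> // c cB cx cb; apply: bmax => //.
  by rewrite inE cB cx.
have parB x : x \in B -> par x = a by case: (parP x).
have parA x : x \in A -> x != a ->
  par x \in B /\ ((o a (par x) x /\
     {in B, forall b, o a b x -> b != par x -> o a b (par x)})
   \/ (par x = m /\ {in B, forall b, o a x b})) by case: (parP x).
have SAB x : x \in S -> (x \in A) || (x \in B).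
  by move=> xS; rewrite inE xS andbT orbN.
have BA x y : x \in A -> y \in B -> x != y.
  by move=> xA yB; apply: contraTneq yB => <-; rewrite inE xA.
(* No point of [B] lies strictly between [y] and its parent in the angular order at [a], so both are
   on the same side of the line ax. *)
have crossBA x y : x \in B -> y \in A -> y != a ->
    [set x; par x] != [set y; par y] -> ~ cross [set x; par x] [set y; par y].
  move=> xB yA ya; have [pB pP] := parA y yA ya; rewrite (parB x xB).
  have [->|xp] := eqVneq x (par y).
    rewrite [ [set y; _] ]setUC; apply: ncross_common; first exact: naB.
    by rewrite eq_sym BA.
  move=> _; have yx := BA y x yA xB.
  have xa := naB x xB; rewrite eq_sym in yx.
  have right : o a x y -> o a x (par y) -> ~ cross [set x; a] [set y; par y].
    by apply: ncross_sep; rewrite ?oxyx ?oxyy.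
  have left : o a y x -> o a (par y) x -> ~ cross [set x; a] [set y; par y].
    rewrite -(oC x a) -(oC x a); apply: ncross_sep; by rewrite ?oxyx ?oxyy.
  case: pP => [[py max_py]|[pm min_y]].
    have /orP[xy|yx'] := tot x y xa ya yx.
      by apply: right => //; apply: max_py.
    by apply: left => //; exact: extreme_trans py yx'.
  by apply: left; [exact: min_y|rewrite pm; apply: mmin; rewrite -?pm].
(* The line through [a] and the parent of [y] separates the two edges. *)
have crossAA x y : x \in A -> x != a -> y \in A -> y != a ->
    o a (par x) (par y) -> ~ cross [set x; par x] [set y; par y].
  move=> xA xa yA ya pxy.
  have [xB xP] := parA x xA xa; have [yB yP] := parA y yA ya.
  have pxny : par x != par y by apply: contraTneq pxy => ->; rewrite oxyy.
  have oxp : o a x (par y).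
    case: xP => [[px max_x]|[_ ->//]].
    have xpy := BA x (par y) xA yB.
    have /orP[//|pyx] := tot x (par y) xa (naB _ yB) xpy.
    have := max_x _ yB pyx; rewrite eq_sym pxny => /(_ isT).
    by rewrite (o_antir pxy).
  have oyp : o a (par y) y.
    case: yP => [[]//|[ym _]]; move: pxy; rewrite ym o_antir//.
    by apply: mmin; rewrite // -ym.
  apply: (@ncross_sepC (par y) a).
  - by rewrite -oC o_antir// oC.
  - by rewrite oxyx.
  - by rewrite oC.
  - by rewrite oC.
(* The root is [a], its children are the points of [B], and the rest of [A] hangs below [B]. *)
exists a, par, (fun x => if x == a then 0 else if x \in B then 1 else 2).
split=> // [x xS xa|x y xS xa yS ya ne].
  have /orP[xA|xB] := SAB x xS.
    have [pB _] := parA x xA xa.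
    rewrite (negPf xa) pB (negPf (naB _ pB)); split; last exact: ncD.
      by move: pB; rewrite inE => /andP[].
    by rewrite inE xA.
  rewrite (parB x xB) (negPf xa) xB eqxx; split=> //.
  by rewrite setUC ncD.
have /orP[xA|xB] := SAB x xS; have /orP[yA|yB] := SAB y yS.
- have [pxy|pxy] := eqVneq (par x) (par y).
    rewrite pxy ![ [set _; par y] ]setUC; apply: ncross_common.
    - by rewrite -pxy eq_sym BA//; case: (parA x xA xa).
    - by rewrite eq_sym BA//; case: (parA y yA ya).
    - by apply: contraNneq ne; rewrite pxy ![ [set _; par y] ]setUC => ->.
  have [pB _] := parA x xA xa; have [qB _] := parA y yA ya.
  have /orP[h|h] := tot _ _ (naB _ pB) (naB _ qB) pxy.
    exact: crossAA.
  by move=> /crossC; exact: crossAA.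
- by move=> /crossC; apply: crossBA => //; rewrite eq_sym.
- exact: crossBA.
- rewrite (parB x xB) (parB y yB) ![ [set _; a] ]setUC.
  apply: ncross_common; rewrite 1?eq_sym// eq_sym.
  by move: ne; rewrite (parB x xB) (parB y yB) ![ [set _; a] ]setUC.
Qed.

Lemma sparse_cut (S : {set V}) (D : {set {set V}}) : S != set0 ->
  #|[set e in D | e \subset S]| + 1 < #|S| ->
  exists2 A : {set V}, [&& A != set0, A \subset S & A != S] &
    {in A & S :\: A, forall x y, [set x; y] \notin D}.
Proof.
move=> /set0Pn[v vS] sparse.
(* A largest vertex set spanning at least |A| - 1 edges cannot be left by an edge. *)
pose dense := [pred A : {set V} | [&& A != set0, A \subset S &
  #|A| <= #|[set e in D | e \subset A]| + 1]].
have dv : dense [set v].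
  by rewrite /= -card_gt0 cards1 sub1set vS addn1 ltnS leq0n.
have [A /and3P[A0 AS cA] max] := @arg_maxnP _ _ dense (fun A => #|A|) dv.
exists A.
  rewrite A0 AS /=; apply: contraTneq sparse => AE.
  by rewrite -leqNgt -AE.
move=> x y xA; rewrite inE => /andP[yA yS]; apply/negP => xyD.
have : dense (y |: A).
  rewrite /= subUset sub1set yS AS /= cardsU1 yA -card_gt0 cardsU1 yA /=.
  rewrite add1n addn1 ltnS (leq_trans cA)// addn1.
  apply: proper_card; apply/properP; split.
    apply/subsetP => e; rewrite !inE => /andP[-> eA]/=.
    by apply: subset_trans eA _; exact: subsetUr.
  exists [set x; y].
    by rewrite inE xyD subUset !sub1set !inE eqxx xA orbT.
  by rewrite inE xyD subUset !sub1set xA (negPf yA).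
by move=> /max /=; rewrite cardsU1 yA add1n ltnn.
Qed.

(** The bichromatic tree is built from the side of the sparse cut that contains [a]. *)
Lemma sparse_avoidable (S : {set V}) (D : {set {set V}}) a : a \in S ->
  extreme a -> #|[set e in D | e \subset S]| + 1 < #|S| -> avoidable S D.
Proof.
move=> aS ea sparse.
have [|A /and3P[A0 AS AnS] ncD] := sparse_cut _ sparse.
  by apply/set0Pn; exists a.
have [aA|aA] := boolP (a \in A); first exact: (bichromatic_tree ea aA AS AnS ncD).
have SSA : S :\: (S :\: A) = A by rewrite setDDr setDv set0U (setIidPr AS).
apply: (@bichromatic_tree S (S :\: A) D a) => //.
- by rewrite inE aA.
- exact: subsetDl.
- by apply: contraNneq A0 => e; rewrite -SSA e setDv.
- by rewrite SSA => x y xSA yA; rewrite setUC ncD.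
Qed.

(** Attach [v] to [w] as a leaf: all other points are on one side of the line vw, and edges at [w]
    share an end with the new edge. *)
Lemma avoidable_leaf (D : {set {set V}}) v w : hull_edge v w || hull_edge w v ->
  [set v; w] \notin D -> avoidable (setT :\ v) D -> avoidable setT D.
Proof.
move=> vw vwD [r [par [h [rS parP plane]]]].
have [wv side] : w != v /\ ((forall x, x != v -> x != w -> o v w x) \/
    (forall x, x != v -> x != w -> o w v x)).
  move: vw => /orP[]/hull_edgeP[ne side].
    by split; [rewrite eq_sym|left].
  by split=> //; right => x xv xw; exact: side.
have rv : r != v by move: rS; rewrite !inE andbT.
have inS x : (x \in setT :\ v) = (x != v) by rewrite !inE andbT.
have vnr : v != r by rewrite eq_sym.
have ncv x : x != v -> x != r -> ~ cross [set v; w] [set x; par x].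
  move=> xv xr; have [] := parP x; rewrite ?inS// => pxv hx _.
  have xpx : x != par x by apply: contraTneq hx => <-; rewrite ltnn.
  have nvx : [set v; w] != [set x; par x].
    apply/eqP => /setP/(_ v); rewrite !inE eqxx [v == x]eq_sym [v == par x]eq_sym.
    by rewrite (negPf xv) (negPf pxv).
  have [xw|xw] := eqVneq x w.
    move: nvx; rewrite xw [ [set v; w] ]setUC => nvx.
    by apply: ncross_common => //; rewrite -xw.
  have [pw|pw] := eqVneq (par x) w.
    move: nvx; rewrite pw [ [set v; w] ]setUC [ [set x; w] ]setUC => nvx.
    by apply: ncross_common; rewrite // eq_sym.
  by case: side => side; [apply: (@ncross_sep v w)|apply: (@ncross_sep w v)];
    rewrite ?oxyx ?oxyy ?side.
exists r, (fun x => if x == v then w else par x),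
  (fun x => if x == v then (h w).+1 else h x).
split=> [|x _ xr|x y _ xr _ yr]; first by rewrite inE.
  have [->|xv] := eqVneq x v; first by rewrite (negPf wv) inE.
  have [] := parP x; rewrite ?inS// => pxv hx pD.
  by rewrite (negPf pxv) inE.
have [->|xv] := eqVneq x v; have [->|yv] := eqVneq y v.
- by rewrite eqxx.
- by move=> _; exact: ncv.
- by move=> _ /crossC; exact: ncv.
- by apply: plane; rewrite ?inS.
Qed.

(** These are the first and the last point in the angular order around [v]; a third point tells them
    apart. *)
Lemma extreme_hull_edges v : extreme v -> 2 < #|V| -> exists w w',
  [/\ hull_edge v w, hull_edge w' v & w != w'].
Proof.
move=> ev V2.
have S0 : setT :\ v != set0.
  by rewrite -card_gt0; move: V2; rewrite -cardsT (cardsD1 v) inE; case: #|_|.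
have tot x y : x \in setT :\ v -> y \in setT :\ v -> x != y -> o v x y || o v y x.
  rewrite !inE !andbT => xv yv xy; case: (boolP (o v x y)) => //= h.
  by apply: o_totalr; rewrite // eq_sym.
have [w wS wmin] : exists2 b, b \in setT :\ v &
    {in setT :\ v, forall x, x != b -> o v b x}.
  apply: (@transitive_max (fun x y => o v y x)) => // [x|x y z|x y xC yC xy].
  - exact: oxyy.
  - by move=> h1 h2; exact: extreme_trans h2 h1.
  - by apply: tot; rewrite // eq_sym.
have [w' wS' wmax] : exists2 b, b \in setT :\ v &
    {in setT :\ v, forall x, x != b -> o v x b}.
  apply: (@transitive_max (o v)) => // [x|x y z].
  - exact: oxyy.
  - exact: extreme_trans.
rewrite !inE !andbT in wS wS'.
have [z zv zw] : exists2 z, z != v & z != w.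
  have /card_gt0P[z] : 0 < #|~: [set v; w]|.
    by rewrite -(ltn_add2l #|[set v; w]|) cardsC addn0 (leq_ltn_trans _ V2)// cards2;
      case: eqVneq.
  by rewrite !inE negb_or => /andP[]; exists z.
exists w, w'; split.
- by apply/hull_edgeP; split=> [|x xv xw]; rewrite 1?eq_sym// wmin// !inE xv.
- apply/hull_edgeP; split=> // x xw' xv.
  by rewrite oC wmax// !inE xv.
- apply/eqP => ww'; have := wmin z; have := wmax z.
  rewrite -ww' !inE zv zw => /(_ isT isT) h /(_ isT isT).
  by rewrite (o_antir h).
Qed.

(** * Edge sets that no plane tree avoids *)

Definition degree (D : {set {set V}}) v := #|[set e in D | v \in e]|.

Lemma card_neighbours (D : {set {set V}}) v (W : {set V}) :
  {in W, forall w, [set v; w] \in D} -> #|W| <= degree D v.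
Proof.
move=> WD; rewrite -(@card_imset _ _ (fun w => [set v; w])) => [|x y /setP xy].
  apply: subset_leq_card; apply/subsetP => _ /imsetP[w wW ->].
  by rewrite inE WD//= !inE eqxx.
have := xy x; have := xy y; rewrite !inE !eqxx !orbT.
by have [->|_] := eqVneq y v; [rewrite orbb => _ /esym/eqP|move=> /eqP].
Qed.

(** With degree at least 2 at [v], at most |V| - 3 edges of [D] lie on the |V| - 1 other points.
    This is sparse, and a plane tree on them takes [v] as a leaf at [w]. *)
Lemma unavoidable_degree (D : {set {set V}}) v w a : a != v -> extreme a ->
  #|D| < #|V| -> ~ avoidable setT D ->
  hull_edge v w || hull_edge w v -> [set v; w] \notin D -> degree D v <= 1.
Proof.
move=> av ea Dn unav vw vwD; rewrite leqNgt; apply/negP => deg2.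
apply: unav; apply: (avoidable_leaf vw vwD).
apply: (@sparse_avoidable _ _ a) => //; first by rewrite !inE av.
have -> : [set e in D | e \subset setT :\ v] = D :\: [set e in D | v \in e].
  apply/setP => e; rewrite !inE subsetD1 subsetT /=.
  by case: (e \in D); rewrite //= ?andbT ?andbF.
have -> : #|setT :\ v| = #|V| - 1.
  by rewrite -cardsT [in RHS](cardsD1 v) inE add1n subn1.
have sub : [set e in D | v \in e] \subset D by apply/subsetP => e; rewrite inE => /andP[].
have := subset_leq_card sub; rewrite cardsDS// -/(degree D v).
move: deg2 Dn; move: (degree D v) #|D| #|V| => x y z; lia.
Qed.

Lemma unavoidable_connected (D : {set {set V}}) a (A : {set V}) : extreme a ->
  ~ avoidable setT D -> A != set0 -> A != setT ->
  exists x y, [/\ x \in A, y \notin A & [set x; y] \in D].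
Proof.
move=> ea unav A0 AT.
have [/existsP[[x y] /= /and3P[]]|none] :=
  boolP [exists w : V * V, [&& w.1 \in A, w.2 \notin A & [set w.1; w.2] \in D]].
  by exists x, y.
exfalso; apply: unav.
have ncD x y : x \in A -> y \notin A -> [set x; y] \notin D.
  move=> xA yA; apply: contraNN none => xyD.
  by apply/existsP; exists (x, y); rewrite /= xA yA.
have [aA|aA] := boolP (a \in A).
  apply: (bichromatic_tree ea aA (subsetT A) AT) => x y xA.
  by rewrite inE => /andP[yA _]; exact: ncD.
apply: (@bichromatic_tree _ (~: A) D a) => //.
- by rewrite inE.
- by apply: contraNneq A0 => e; rewrite -[A]setCK e setCT.
- by move=> x y xA; rewrite !inE negbK andbT => yA; rewrite setUC ncD// -in_setC.
Qed.

Section Exchange.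
Variable p : V.
Hypothesis ext : forall a, a != p -> extreme a.
Hypothesis np : ~~ extreme p.
(** To be instantiated by the sets of unselected edges, over all selections of one edge per colour;
    an exchange changes the selected edge of one colour. *)
Variable family : {set {set V}} -> Prop.
Hypothesis family_edges : forall D, family D -> forall e, e \in D -> #|e| = 2.
Hypothesis family_card : forall D, family D -> #|D| < #|V|.
Hypothesis family_exchange : forall D d, family D -> d \in D ->
  exists2 f, f \notin D & family (f |: (D :\ d)).

Lemma family_avoidable D : family D -> exists2 D, family D & avoidable setT D.
Proof.
move=> famD; have [//|none] := boolp.pselect (exists2 D, family D & avoidable setT D).
have unav D' : family D' -> ~ avoidable setT D' by move=> fD' aD'; apply: none; exists D'.
have [b [c [d [pbc pcd pdb]]]] := extremePn np.
have [pb bc pc] := o_neq pbc; have [_ cd pd] := o_neq pcd; have [_ db _] := o_neq pdb.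
have V2 : 2 < #|V|.
  by have := max_card (mem [:: p; b; c]); rewrite (card_uniqP (o_uniq pbc)).
have other v : exists2 a, a != v & extreme a.
  have [bv|bv] := eqVneq b v; last by exists b => //; rewrite ext// eq_sym.
  by exists c; [rewrite -bv eq_sym|rewrite ext// eq_sym].
have deg1 D' v w : family D' -> hull_edge v w || hull_edge w v ->
    [set v; w] \notin D' -> degree D' v <= 1.
  move=> fD' vw vwD'; have [a av ea] := other v.
  exact: unavoidable_degree av ea (family_card fD') (unav _ fD') vw vwD'.
have conn D' (A : {set V}) : family D' -> A != set0 -> A != setT ->
    exists x y, [/\ x \in A, y \notin A & [set x; y] \in D'].
  move=> fD'; have [a _ ea] := other p.
  exact: unavoidable_connected ea (unav _ fD').
(* Exchanging vw away removes a single edge at [v], and [deg1] applies to the resulting member. *)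
have deg2 D' v w : family D' -> hull_edge v w || hull_edge w v ->
    [set v; w] \in D' -> degree D' v <= 2.
  move=> fD' vw vwD'; have [f fnD' fD''] := family_exchange fD' vwD'.
  have := deg1 _ _ _ fD'' vw.
  rewrite !inE eqxx /= orbF => h.
  have {}h : degree (f |: D' :\ [set v; w]) v <= 1.
    by apply: h; apply: contraNneq fnD' => <-.
  rewrite /degree (cardsD1 [set v; w]) (leq_add (leq_b1 _))//.
  apply: leq_trans h; apply: subset_leq_card; apply/subsetP => e.
  by rewrite !inE => /and3P[-> -> ->]; rewrite orbT.
pose star := [set [set p; v] | v in setT :\ p].
(* Two members that differ by an exchange cannot both be the star. *)
suff famE D' : family D' -> D' = star.
  have [||x [y [_ _ xyD]]] := conn D [set p] famD.
  - by rewrite -card_gt0 cards1.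
  - by apply/negP => /eqP/setP/(_ b); rewrite !inE eq_sym (negPf pb).
  have [f fnD fD'] := family_exchange famD xyD.
  by move: fnD; rewrite (famE _ famD) -(famE _ fD') !inE eqxx.
have nbr v : v != p -> exists w w',
    [/\ hull_edge v w, hull_edge w' v & w != w'].
  by move=> vp; exact: extreme_hull_edges (ext vp) V2.
have noncentral v w : v != p -> hull_edge v w || hull_edge w v -> w != p.
  move=> vp /orP[]h; apply: contraNneq np => <-; first exact: hull_edge_extremer h.
  exact: hull_edge_extremel h.
move=> fD'.
have no_hull v w : v != p -> hull_edge v w || hull_edge w v -> [set v; w] \notin D'.
  move=> vp vw; apply/negP => vwD'.
  (* The points on hull edges of [D']. Since [p] is not among them, an edge xy of [D'] leaves this
     set; it remains to see that xy is a hull edge, a contradiction. *)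
  pose A := [set v | (v != p) && [exists w,
    (hull_edge v w || hull_edge w v) && ([set v; w] \in D')]].
  have [||x [y [xA yA xyD']]] := conn D' A fD'.
  - by apply/set0Pn; exists v; rewrite inE vp; apply/existsP; exists w; rewrite vw.
  - by apply/negP => /eqP/setP/(_ p); rewrite !inE eqxx.
  move: xA; rewrite inE => /andP[xp /existsP[w0 /andP[xw0 xw0D']]].
  have [u [u' [xu xu' uu']]] := nbr x xp.
  suff xy : hull_edge x y || hull_edge y x.
    move/negP: yA; apply; rewrite inE (noncentral x y)//=.
    by apply/existsP; exists x; rewrite orbC xy setUC.
  have [->//|yw0] := eqVneq y w0.
  (* By [deg1], degree 2 at [x] puts both hull edges at [x] into [D']; by [deg2] there is no third
     edge, so [y] is an end of one of them. *)
  have d2 : 1 < degree D' x.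
    have := @card_neighbours D' x [set y; w0]; rewrite cards2 yw0; apply.
    by move=> z; rewrite !inE => /orP[]/eqP->.
  have uD' z : hull_edge x z || hull_edge z x -> [set x; z] \in D'.
    move=> xz; apply: contraTT d2 => xzD'; rewrite -leqNgt.
    exact: deg1 fD' xz xzD'.
  have [->|yu] := eqVneq y u; first by rewrite xu.
  have [->|yu'] := eqVneq y u'; first by rewrite xu' orbT.
  have := deg2 _ _ _ fD' xw0 xw0D'; rewrite leqNgt => /negP[].
  have := @card_neighbours D' x (y |: [set u; u']).
  rewrite cardsU1 cards2 !inE negb_or yu yu' uu'; apply => z.
  by rewrite !inE => /or3P[]/eqP->//; apply: uD'; rewrite ?xu ?xu' ?orbT.
have leaf x : x != p -> degree D' x <= 1.
  move=> xp; have [u [_ [xu _ _]]] := nbr x xp.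
  have xu' : hull_edge x u || hull_edge u x by rewrite xu.
  exact: deg1 fD' xu' (no_hull x u xp xu').
have leaf_uniq x y z : x != p -> [set x; y] \in D' -> [set x; z] \in D' -> y = z.
  move=> xp xy xz; apply/eqP; apply: contraTT (leaf x xp) => yz; rewrite -ltnNge.
  have := @card_neighbours D' x [set y; z]; rewrite cards2 yz; apply.
  by move=> u; rewrite !inE => /orP[]/eqP->.
(* Two adjacent leaves other than [p] would form a component of [D']. *)
have spoke x y : x != p -> [set x; y] \in D' -> y = p.
  move=> xp xyD'; apply/eqP; apply: contraT => yp.
  have [||z [u [zxy uxy zuD']]] := conn D' [set x; y] fD'.
  - by apply/set0Pn; exists x; rewrite !inE eqxx.
  - by apply: contraTneq V2 => /(congr1 (fun A : {set V} => #|A|));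
      rewrite cardsT cards2 => <-; case: eqVneq.
  move: uxy; rewrite !inE negb_or => /andP[ux uy].
  move: zxy zuD'; rewrite !inE => /orP[]/eqP-> h.
    by rewrite (leaf_uniq x y u xp xyD' h) eqxx in uy.
  by rewrite setUC in xyD'; rewrite (leaf_uniq y x u yp xyD' h) eqxx in ux.
apply/setP => e; apply/idP/imsetP => [eD'|[x xp ->]].
  have /eqP/cards2P[x [y [xy eE]]] := family_edges fD' eD'.
  move: eD'; rewrite eE => eD'; have [xp|xp] := eqVneq x p.
    by exists y; rewrite ?xp// !inE andbT -xp eq_sym.
  by exists x; rewrite ?inE ?xp// (spoke x y xp eD') setUC.
rewrite !inE andbT in xp.
have [||z [y [/set1P-> _ xyD']]] := conn D' [set x] fD'.
- by rewrite -card_gt0 cards1.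
- by apply/negP => /eqP/setP/(_ p); rewrite !inE eq_sym (negPf xp).
by move: (xyD'); rewrite (spoke x y xp xyD') setUC.
Qed.
End Exchange.

End Orientation.

(** * The orientation of points of the plane *)

From mathcomp Require Import all_classical all_reals all_analysis.
From mathcomp Require Import ring lra.
Import Order.TTheory GRing.Theory Num.Theory numFieldNormedType.Exports.

Section Plane.
Local Open Scope ring_scope.
Local Open Scope classical_set_scope.
Variable R : realType.
Implicit Types a b c d q : 'rV[R]_2.

(** Twice the signed area of the triangle abc. *)
Definition det a b c : R :=
  (b 0 0 - a 0 0) * (c 0 1 - a 0 1) - (b 0 1 - a 0 1) * (c 0 0 - a 0 0).

Lemma det_rot a b c : det a b c = det b c a.
Proof. by rewrite /det; ring. Qed.

Lemma det_swap a b c : det b a c = - det a b c.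
Proof. by rewrite /det; ring. Qed.

Lemma det_same a b : det a a b = 0.
Proof. by rewrite /det; ring. Qed.

Lemma det_pluecker p x y z w :
  det p x y * det p z w + det p x w * det p y z = det p x z * det p y w.
Proof. by rewrite /det; ring. Qed.

Lemma det_comb a b x y (s t : R) : s + t = 1 ->
  det a b (s *: x + t *: y) = s * det a b x + t * det a b y.
Proof. by move=> /(canRL (addrK _)) ->; rewrite /det !mxE; ring. Qed.

Lemma row2P a b : a 0 0 = b 0 0 -> a 0 1 = b 0 1 -> a = b.
Proof.
move=> e0 e1; apply/rowP => -[[|[|//]] i2].
- by move: e0; congr (a 0 _ = b 0 _); exact: val_inj.
- by move: e1; congr (a 0 _ = b 0 _); exact: val_inj.
Qed.

Lemma det_eq0 a b c : a != b -> det a b c = 0 ->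
  exists u v, [/\ v != 0, line u v a, line u v b & line u v c].
Proof.
move=> ab d0; exists a, (b - a); split.
- by rewrite subr_eq0 eq_sym.
- by exists 0 => //; rewrite scale0r addr0.
- by exists 1 => //; rewrite scale1r addrC subrK.
have [e|ne] := eqVneq (b 0 0) (a 0 0).
  have ne1 : b 0 1 - a 0 1 != 0.
    rewrite subr_eq0; apply: contraNneq ab => e1; apply/eqP; exact: row2P.
  exists ((c 0 1 - a 0 1) / (b 0 1 - a 0 1)) => //; apply: row2P; rewrite !mxE.
    rewrite e subrr mulr0 addr0; apply/esym/eqP; rewrite -subr_eq0.
    move: d0; rewrite /det e subrr mul0r sub0r => /eqP.
    by rewrite oppr_eq0 mulf_eq0 (negPf ne1).
  by field.
have ne0 : b 0 0 - a 0 0 != 0 by rewrite subr_eq0.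
exists ((c 0 0 - a 0 0) / (b 0 0 - a 0 0)) => //; apply: row2P; rewrite !mxE.
  by field.
have : (b 0 0 - a 0 0) * (c 0 1 - a 0 1) = (b 0 1 - a 0 1) * (c 0 0 - a 0 0).
  by apply/eqP; rewrite -subr_eq0 -[X in X == 0]/(det a b c) d0.
move=> h; apply: (mulfI ne0).
transitivity ((b 0 0 - a 0 0) * a 0 1 + (b 0 0 - a 0 0) * (c 0 1 - a 0 1)).
  by rewrite h; field.
by ring.
Qed.

Lemma segmentP a b q : segment a b q <->
  exists s t : R, [/\ 0 <= s, 0 <= t, s + t = 1 & q = s *: a + t *: b].
Proof.
split=> [[t _ <-]|[s [t [s0 t0 st ->]]]].
  by exists t%:num, (1 - t%:num); split=> //; rewrite addrC subrK.
have s1 : s <= 1 by rewrite -st lerDl.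
exists (Itv01 s0 s1) => //; change (s *: a + (1 - s) *: b = s *: a + t *: b).
by rewrite -st [s + t]addrC addrK.
Qed.

Lemma convex_hull_comb (A : set 'rV[R]_2) a b (s t : R) :
  convex_hull A a -> convex_hull A b -> 0 <= s -> 0 <= t -> s + t = 1 ->
  convex_hull A (s *: a + t *: b).
Proof.
move=> ha hb s0 t0 st C [cC AC].
have [l _ <-] := (segmentP a b (s *: a + t *: b)).2
  (ex_intro _ s (ex_intro _ t (And4 s0 t0 st erefl))).
have := cC a b l; rewrite !inE; apply; [exact: ha|exact: hb].
Qed.

(** The determinants divided by their sum are the barycentric coordinates of [q]. Convexity is
    binary, so [a] and [b] are combined first. *)
Lemma convex_hull_triangle (A : set 'rV[R]_2) a b c q : A a -> A b -> A c ->
  0 < det a b q -> 0 < det b c q -> 0 < det c a q -> convex_hull A q.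
Proof.
move=> Aa Ab Ac ab bc ca.
have : (det a b q + (det b c q + det c a q)) *: q =
    det b c q *: a + det c a q *: b + det a b q *: c.
  by apply: row2P; rewrite !mxE /det; ring.
move: (det a b q) (det b c q) (det c a q) ab bc ca => w u v w0 u0 v0.
have s0 : 0 < u + v := addr_gt0 u0 v0; have D0 := addr_gt0 w0 s0.
have sne := lt0r_neq0 s0; have Dne := lt0r_neq0 D0.
move=> /(congr1 ( *:%R (w + (u + v))^-1)); rewrite scalerA mulVf// scale1r => ->.
have -> : (w + (u + v))^-1 *: (u *: a + v *: b + w *: c) =
    ((u + v) / (w + (u + v))) *: ((u / (u + v)) *: a + (v / (u + v)) *: b)
    + (w / (w + (u + v))) *: c.
  rewrite !scalerDr !scalerA; congr (_ *: _ + _ *: _ + _ *: _); by field; rewrite ?Dne ?sne.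
apply: convex_hull_comb; last by rewrite -mulrDl addrC divff.
- apply: convex_hull_comb; last by rewrite -mulrDl divff.
  + exact: sub_gen_smallest.
  + exact: sub_gen_smallest.
  + by rewrite divr_ge0// ltW.
  + by rewrite divr_ge0// ltW.
- exact: sub_gen_smallest.
- by rewrite divr_ge0// ltW.
- by rewrite divr_ge0// ltW.
Qed.

Lemma det_continuous a b : continuous (det a b).
Proof.
move=> q.
have coordB i : (fun c : 'rV[R]_2 => c 0 i - a 0 i : R) @ q --> q 0 i - a 0 i.
  by apply: (@cvgB _ R^o _ (nbhs q)); [exact: coord_continuous|exact: cvg_cst].
have scaleB k i : (fun c : 'rV[R]_2 => k * (c 0 i - a 0 i) : R) @ q -->
    k * (q 0 i - a 0 i).
  by apply: (@cvgM _ _ (nbhs q)); [exact: cvg_cst|exact: coordB].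
by apply: (@cvgB _ R^o _ (nbhs q)); exact: scaleB.
Qed.

(** The three strict inequalities persist near [q], so a neighbourhood of [q] lies in the hull. *)
Lemma interior_triangle (A : set 'rV[R]_2) a b c q : A a -> A b -> A c ->
  0 < det a b q -> 0 < det b c q -> 0 < det c a q ->
  ~ frontier (convex_hull A) q.
Proof.
move=> Aa Ab Ac ab bc ca [_]; apply.
have near_det x y : 0 < det x y q -> \forall z \near q, 0 < det x y z.
  exact: (cvgr_gt (det x y q) (@det_continuous x y q)).
apply: filterS3 (near_det _ _ ab) (near_det _ _ bc) (near_det _ _ ca) => z.
exact: convex_hull_triangle.
Qed.
End Plane.

(** * Orientation and crossings within the point set *)

Section PointSet.
Local Open Scope ring_scope.
Variables (R : realType) (P : {fset 'rV[R]_2}).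
Hypothesis Pgen : general_position P.
Implicit Types x y z w : P.

Definition ccw x y z := 0 < det (val x) (val y) (val z).

Lemma ccw_rot x y z : ccw x y z = ccw y z x.
Proof. by rewrite /ccw det_rot. Qed.

Lemma ccw_same x z : ccw x x z = false.
Proof. by rewrite /ccw det_same ltxx. Qed.

Lemma det_neq0 x y z : uniq [:: x; y; z] -> det (val x) (val y) (val z) != 0.
Proof.
rewrite /= !inE negb_or => /andP[/andP[xy xz] /andP[yz _]].
apply/eqP => d0; apply: (Pgen (valP x) (valP y) (valP z)) => //.
exact: det_eq0 d0.
Qed.

Lemma ccw_swap x y z : uniq [:: x; y; z] -> ccw y x z = ~~ ccw x y z.
Proof.
move=> /det_neq0 d0; rewrite /ccw det_swap oppr_gt0 -leNgt le_eqVlt.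
by rewrite (negPf d0).
Qed.

(** The left side of [det_pluecker] is positive, so the two factors on the right have the same
    sign. *)
Lemma ccw_pluecker p x y z w : ccw p x y -> ccw p z w -> ccw p x w -> ccw p y z ->
  ccw p x z = ccw p y w.
Proof.
rewrite /ccw => xy zw xw yz.
have h : 0 < det (val p) (val x) (val z) * det (val p) (val y) (val w).
  by rewrite -det_pluecker; exact: addr_gt0 (mulr_gt0 xy zw) (mulr_gt0 xw yz).
move: h; set u := det _ _ _; set v := det _ _ _ => h.
apply/idP/idP => uv; first by rewrite -(pmulr_rgt0 _ uv).
by rewrite -(pmulr_lgt0 _ uv).
Qed.

Lemma crossing_sym (e f : {set P}) : crossing e f -> crossing f e.
Proof.
move=> [q [qe qf nq]]; exists q; split=> // -[x xfe xq]; apply: nq; exists x => //.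
by move: xfe; rewrite !inE andbC.
Qed.

Lemma edge_segmentP x y q : edge_segment [set x; y]%SET q <->
  exists s t : R, [/\ 0 <= s, 0 <= t, s + t = 1 & q = s *: val x + t *: val y].
Proof.
split=> [[x' [y' [e /segmentP[s [t [s0 t0 st qE]]]]]]|h]; last first.
  by exists x, y; split=> //; apply/segmentP.
have [xe ye] : x \in [set x'; y']%SET /\ y \in [set x'; y']%SET.
  by rewrite -e !inE !eqxx orbT.
have [xe' ye'] : x' \in [set x; y]%SET /\ y' \in [set x; y]%SET.
  by rewrite e !inE !eqxx orbT.
have q_swap : s *: val x' + t *: val y' = t *: val y' + s *: val x' := addrC _ _.
move: xe ye xe' ye'; rewrite !inE => /orP[]/eqP xE /orP[]/eqP yE /orP[]/eqP xE' /orP[]/eqP yE';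
  solve [by exists s, t; split=> //; congruence
       | by exists t, s; split; rewrite 1?[t + s]addrC//; congruence].
Qed.

Lemma crossing_intro x y z w : ccw x y z -> ccw y x w -> ccw z w x != ccw z w y ->
  crossing [set x; y]%SET [set z; w]%SET.
Proof.
move=> xyz yxw ne.
pose A := det (val x) (val y) (val z); pose B := det (val x) (val y) (val w).
pose C := det (val z) (val w) (val x); pose D := det (val z) (val w) (val y).
have A0 : 0 < A by [].
have B0 : B < 0 by move: yxw; rewrite /ccw det_swap oppr_gt0.
have CD : D - C = A - B by rewrite /A /B /C /D /det; ring.
have N0 : 0 < A - B by rewrite subr_gt0 (lt_trans B0).
(* The inequality [ne] leaves two sign patterns, and D - C = A - B > 0 excludes one. [C] may vanish
   here, as [ccw] is strict. *)
have [C0 D0] : C <= 0 /\ 0 < D.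
  move: ne; rewrite /ccw -/C -/D.
  case: (ltP 0 C); case: (ltP 0 D) => // D0 C0 _.
  by exfalso; move: N0; rewrite -CD; lra.
have Nne := lt0r_neq0 N0.
(* Divided by A - B, both sides are the common point of the two segments. *)
have qE : D *: val x + (- C) *: val y = (- B) *: val z + A *: val w.
  by apply: row2P; rewrite !mxE /A /B /C /D /det; ring.
exists ((D / (A - B)) *: val x + (- C / (A - B)) *: val y); split.
- apply/edge_segmentP; exists (D / (A - B)), (- C / (A - B)); split=> //.
  + by rewrite divr_ge0// ltW.
  + by rewrite divr_ge0 ?oppr_ge0// ltW.
  + by rewrite -mulrDl CD divff.
- apply/edge_segmentP; exists (- B / (A - B)), (A / (A - B)); split.
  + by rewrite divr_ge0 ?oppr_ge0// ltW.
  + by rewrite divr_ge0// ltW.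
  + by rewrite -mulrDl addrC divff.
  + by rewrite ![_ / (A - B)]mulrC -!scalerA -!scalerDr qE.
(* The edges have no common vertex, so the common point is not a shared end. *)
move=> [u]; rewrite !inE => /andP[uxy uzw] _.
move: uxy uzw xyz yxw => /orP[]/eqP-> /orP[]/eqP-> h1 h2.
- by move: h1; rewrite -ccw_rot ccw_same.
- by move: h2; rewrite ccw_rot ccw_same.
- by move: h1; rewrite ccw_rot ccw_same.
- by move: h2; rewrite -ccw_rot ccw_same.
Qed.

(** The determinant is affine in its last point: at a common point it would be nonpositive along one
    segment and positive along the other. *)
Lemma ccw_separated x y u1 u2 v1 v2 :
  ~~ ccw x y u1 -> ~~ ccw x y u2 -> ccw x y v1 -> ccw x y v2 ->
  ~ crossing [set u1; u2]%SET [set v1; v2]%SET.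
Proof.
rewrite /ccw -!leNgt => u1le u2le v1gt v2gt.
move=> [q [/edge_segmentP[s [t [s0 t0 st qu]]] /edge_segmentP[s' [t' [s0' t0' st' qv]]] _]].
have := det_comb (val x) (val y) (val u1) (val u2) st.
rewrite -qu qv det_comb//.
have h1 := mulr_ge0_le0 s0 u1le; have h2 := mulr_ge0_le0 t0 u2le.
have h3 := mulr_ge0 s0' (ltW v1gt); have h4 := mulr_ge0 t0' (ltW v2gt).
move: v1gt v2gt h1 h2 h3 h4.
set d1 := det _ _ (val u1); set d2 := det _ _ (val u2).
set d3 := det _ _ (val v1); set d4 := det _ _ (val v2).
move: d1 d2 d3 d4 => d1 d2 d3 d4 v1gt v2gt h1 h2 h3 h4 h.
have [s'0|s'0] := eqVneq s' 0.
  have t'1 : t' = 1 by rewrite -st' s'0 add0r.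
  by move: h; rewrite s'0 t'1; lra.
have : 0 < s' * d3 by rewrite mulr_gt0// lt_def s'0.
by lra.
Qed.

(** At a common point the determinant with [x] and [y] vanishes, so [z] has weight 0 and the point
    is the shared end [x]. *)
Lemma share_not_crossing x y z : uniq [:: x; y; z] ->
  ~ crossing [set x; y]%SET [set x; z]%SET.
Proof.
move=> /det_neq0 d0.
move=> [q [/edge_segmentP[s [t [_ _ st qu]]] /edge_segmentP[s' [t' [_ _ st' qv]]] []]].
have := det_comb (val x) (val y) (val x) (val y) st.
rewrite -qu qv det_comb//.
have -> : det (val x) (val y) (val x) = 0 by rewrite -det_rot det_same.
have -> : det (val x) (val y) (val y) = 0 by rewrite det_rot det_same.
rewrite !mulr0 !add0r => /eqP; rewrite mulf_eq0 (negPf d0) orbF => /eqP t'0.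
exists x; first by rewrite !inE eqxx.
have s'1 : s' = 1 by rewrite -st' t'0 addr0.
by rewrite s'1 t'0 scale1r scale0r addr0.
Qed.

Lemma not_extreme_interior x : ~~ extreme ccw x ->
  ~ frontier (convex_hull [set` P]%classic) (val x).
Proof.
move=> /(extremePn ccw_rot ccw_swap ccw_same)[b [c [d [bc cd db]]]].
apply: (@interior_triangle _ _ (val b) (val c) (val d)); try exact: valP.
- by rewrite -det_rot.
- by rewrite -det_rot.
- by rewrite -det_rot.
Qed.

Lemma at_most_one_interior : (interior_number P <= 1)%N ->
  (forall x, extreme ccw x) \/
  (exists2 p, ~~ extreme ccw p & forall x, x != p -> extreme ccw x).
Proof.
move=> i1; have [/existsP[p np]|all_ext] := boolP [exists p, ~~ extreme ccw p].
  right; exists p => // x xp; apply: contraT => nx.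
  move: i1; rewrite leqNgt => /negP[]; apply/card_gt1P; exists x, p.
  by rewrite !inE; split=> //; apply/asboolPn; exact: not_extreme_interior.
by left => x; move: all_ext; rewrite negb_exists => /forallP/(_ x); rewrite negbK.
Qed.

End PointSet.

(** * Colourings and hypergraphs *)

Section HeterochromaticBounds.
Local Open Scope set_scope.
Local Open Scope nat_scope.
Variable H : hypergraph.

Lemma bigmin_le (I : eqType) (r : seq I) (P : pred I) (F : I -> nat) m i :
  i \in r -> P i -> \big[minn/m]_(j <- r | P j) F j <= F i.
Proof.
elim: r => // j r IH; rewrite inE big_cons => /orP[/eqP<- ->|ir Pi].
  exact: geq_minl.
by case: ifP => _; rewrite ?geq_min IH ?orbT.
Qed.

Lemma bigmin_attained (I : eqType) (r : seq I) (P : pred I) (F : I -> nat) m :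
  \big[minn/m]_(j <- r | P j) F j = m \/
  exists2 i, P i & \big[minn/m]_(j <- r | P j) F j = F i.
Proof.
elim: r => [|j r IH]; first by left; rewrite big_nil.
rewrite big_cons; case: ifP => // Pj.
by case: (leqP (F j)) => _; [right; exists j|].
Qed.

Lemma tau_le (T : {set hvertex H}) : double_transversal T -> tau H <= #|T|.
Proof. by move=> dT; apply: bigmin_le; rewrite ?mem_index_enum. Qed.

Lemma double_transversalW (T : {set hvertex H}) :
  double_transversal T -> double_transversal [set: hvertex H].
Proof.
move=> /forall_inP dT; apply/forall_inP => e eH.
apply: leq_trans (dT e eH) _; apply: subset_leq_card.
by apply: finset.setIS; exact: finset.subsetT.
Qed.

(** If the minimum equals its default, the full vertex set attains it, being a double transversal as
    a superset of [T]. *)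
Lemma tau_attained (T : {set hvertex H}) : double_transversal T ->
  exists2 T : {set hvertex H}, double_transversal T & #|T| = tau H.
Proof.
move=> dT; rewrite /tau; set t := \big[_/_]_(_ | _) _.
have [tE|[T' dT' tE]] : t = #|hvertex H| \/
    (exists2 T : {set hvertex H}, double_transversal T & t = #|T|).
  exact: bigmin_attained.
  by exists [set: hvertex H]; [exact: double_transversalW dT|rewrite cardsT].
by exists T'.
Qed.

(** Colour 0 goes to all of [T]; vertices outside [T] take distinct positive colours until these run
    out, and the surplus gets 0 too. Every hyperedge then has two vertices of colour 0. *)
Lemma double_transversal_coloring (T e0 : {set hvertex H}) k :
  e0 \in hedges H -> double_transversal T -> 0 < k <= nu H - #|T| + 1 ->
  ~ forces_heterochromatic H k.
Proof.
move=> e0H /forall_inP dT; case: k => // k /=; rewrite addn1 ltnS => kle.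
pose rank v := index v (enum (~: T)).
pose c := [ffun v : hvertex H => inord (if v \in T then 0 else
  if rank v < k then (rank v).+1 else 0) : 'I_k.+1].
have cT v : v \in T -> c v = ord0.
  by move=> vT; rewrite ffunE vT; apply: val_inj; rewrite /= inordK.
move=> /(_ c)[|e eH hc_e].
  case=> -[|i] ik.
    (* Colour 0 is used because the hyperedge [e0] meets [T]. *)
    have /card_gt0P[v] : 0 < #|e0 :&: T| by rewrite (leq_trans _ (dT e0 e0H)).
    by rewrite inE => /andP[_ vT]; exists v; rewrite cT//; exact: val_inj.
  have iT : i < size (enum (~: T)).
    rewrite -cardE; rewrite ltnS in ik; apply: leq_trans ik _.
    by rewrite (leq_trans kle)// leq_subLR cardsC.
  have [v0 _] : exists v, v \in ~: T.
    by apply/card_gt0P; rewrite cardE; case: (size _) iT.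
  have vT : nth v0 (enum (~: T)) i \in ~: T by rewrite -mem_enum mem_nth.
  exists (nth v0 (enum (~: T)) i); rewrite ffunE; move: (vT); rewrite finset.in_setC.
  move=> /negPf->; rewrite /rank index_uniq ?enum_uniq// -ltnS ik.
  by apply: val_inj; rewrite /= inordK.
have /card_gt1P[x [y []]] := dT e eH.
rewrite !inE => /andP[xe xT] /andP[ye yT] /eqP; apply.
by apply: hc_e; rewrite ?cT.
Qed.

Lemma hcE (T e0 : {set hvertex H}) : e0 \in hedges H -> double_transversal T ->
  forces_heterochromatic H (nu H - tau H + 2) -> hc H = nu H - tau H + 2.
Proof.
move=> e0H /tau_attained[T' dT' <-] forced; rewrite /hc; case: ex_minnP => k.
rewrite /hc_pred => /andP[k0 /asboolP kforced] kmin.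
apply/eqP; rewrite eqn_leq kmin; last by rewrite addn2; apply/asboolP; rewrite -addn2.
rewrite leqNgt; apply/negP => lt_k.
apply: (double_transversal_coloring e0H dT') kforced.
by rewrite k0 -ltnS -addnS.
Qed.

End HeterochromaticBounds.

(** * Plane spanning trees as hyperedges *)

Section PlaneTrees.
Local Open Scope set_scope.
Local Open Scope nat_scope.
Variables (R : realType) (P : {fset 'rV[R]_2}).

Lemma edge_rel_sym (Q : {set {set P}}) : symmetric (edge_rel Q).
Proof. by move=> x y; rewrite /edge_rel /= finset.setUC. Qed.

Lemma spanning_tree_connected (Q : {set {set P}}) :
  spanning_tree Q -> connected_edges Q.
Proof.
move=> [conn _] A /set0Pn[x xA] AT.
have [y yA] : exists y, y \notin A.
  apply/existsP; apply: contraNT AT; rewrite negb_exists => /forallP AT.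
  by apply/eqP/setP => y; rewrite finset.in_setT; have := AT y; rewrite negbK => ->.
have [/existsP[[u v] /= /and3P[uA vA uvQ]]|none] := boolP [exists w : P * P,
    [&& w.1 \in A, w.2 \notin A & [set w.1; w.2] \in Q]].
  by exists u, v.
exfalso; move: yA; suff <- : (x \in A) = (y \in A) by rewrite xA.
apply: (closed_connect _ (conn x y)) => u v uvQ; have {}uvQ : [set u; v] \in Q := uvQ.
apply: contraNeq none => ne.
have [uA|uA] := boolP (u \in A).
  by apply/existsP; exists (u, v); rewrite /= uA uvQ andbT;
    move: ne; rewrite uA; case: (v \in A).
apply/existsP; exists (v, u); rewrite /= uA finset.setUC uvQ andbT.
by move: ne; rewrite (negPf uA); case: (v \in A).
Qed.

(** Parents lead every vertex to the root. On a cycle, both neighbours of a vertex of maximal height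
    would be its parent, hence equal. *)
Lemma parent_spanning_tree (Q : {set {set P}}) r par (h : P -> nat) :
  (forall x y : P, [set x; y] \in Q ->
    x != r /\ y = par x \/ y != r /\ x = par y) ->
  (forall x, x != r -> [set x; par x] \in Q /\ h (par x) < h x) ->
  spanning_tree Q.
Proof.
move=> Qpar parQ; split=> [x y|s s2 /andP[cyc us]].
  have to_root z : connect (edge_rel Q) z r.
    have [n] := ubnP (h z); elim: n z => // n IH z; rewrite ltnS => le_n.
    have [->|zr] := eqVneq z r; first exact: connect0.
    have [zQ lt_h] := parQ z zr.
    apply: connect_trans (connect1 (zQ : edge_rel Q z (par z))) (IH _ _).
    exact: leq_trans lt_h le_n.
  apply: connect_trans (to_root x) _.
  by rewrite (sym_connect_sym (edge_rel_sym Q)).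
have [x0 x0s] : exists x, x \in s.
  by case: s s2 {cyc us} => // x s _; exists x; rewrite inE eqxx.
have [x xs max] := @arg_maxnP _ x0 (mem s) h x0s.
have [i s' sE] := rot_to xs.
have toward y : y \in s -> edge_rel Q x y -> y = par x.
  move=> ys /Qpar[[_ //]|[yr xE]].
  have := max y ys; rewrite /= leqNgt => /negP[].
  by rewrite xE; case: (parQ y yr).
have mem_s y : (y \in s) = (y \in x :: s') by rewrite -sE mem_rot.
move: cyc us s2; rewrite -(rot_cycle i) -(rot_uniq i) -(size_rot i) sE.
case: s' sE mem_s => [//|y s'] sE mem_s /=.
rewrite rcons_path => /and3P[xy _ zx] /and3P[_ ys' _].
case: s' sE mem_s zx ys' => // z s' sE mem_s zx ys' _.
have yE : y = par x by apply: toward; rewrite // mem_s !inE eqxx orbT.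
have zE : last y (z :: s') = par x.
  apply: toward; last by rewrite edge_rel_sym.
  by rewrite mem_s inE mem_last orbT.
by move: ys'; rewrite {1}yE -zE /= mem_last.
Qed.

Lemma avoidable_tree (D : {set {set P}}) : avoidable (@crossing R P) [set: P] D ->
  exists2 Q : {set {set P}}, plane_spanning_tree Q &
    forall e, e \in Q -> #|e| = 2 /\ e \notin D.
Proof.
move=> [r [par [h [_ parP plane]]]].
have parT x : x != r -> h (par x) < h x /\ [set x; par x] \notin D.
  by move=> xr; have [] := parP x; rewrite ?finset.in_setT.
exists [set [set x; par x] | x in [pred x | x != r]]; last first.
  move=> _ /imsetP[x xr ->]; have [hx xD] := parT x xr; split=> //.
  have xpx : x != par x by apply: contraTneq hx => <-; rewrite ltnn.
  by rewrite cards2 xpx.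
split; last first.
  move=> _ _ /imsetP[x xr ->] /imsetP[y yr ->]; apply: plane => //; exact: finset.in_setT.
apply: (@parent_spanning_tree _ r par h) => [x y /imsetP[u ur /setP xyE]|x xr].
  have := xyE u; have := xyE (par u); have := xyE x; have := xyE y.
  have [+ _] := parT u ur; rewrite !inE !eqxx !orbT => hu.
  move=> /esym/orP[]/eqP-> /esym/orP[]/eqP->; rewrite ?orbb.
  - by move=> /eqP uE; move: hu; rewrite uE ltnn.
  - by move=> _ _; right.
  - by move=> _ _; left.
  - by move=> _ /eqP uE; move: hu; rewrite -uE ltnn.
by split; [apply/imsetP; exists x|case: (parT x xr)].
Qed.

Local Notation treeH := (tree_hypergraph (complete_geometric_graph P)).

Lemma edge_card (u : hvertex treeH) : #|val u| = 2.
Proof. by have := valP u; rewrite inE => /eqP. Qed.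

Lemma tree_hyperedge (Q : {set {set P}}) : plane_spanning_tree Q ->
  (forall e, e \in Q -> #|e| = 2) ->
  exists2 T : {set hvertex treeH}, T \in hedges treeH & forall u, (u \in T) = (val u \in Q).
Proof.
move=> treeQ Q2; exists [set u : hvertex treeH | val u \in Q]; last by move=> u; rewrite inE.
rewrite inE; apply/asboolP.
suff -> : [set val x | x in [set u : hvertex treeH | val u \in Q]] = Q by [].
apply/setP => e; apply/imsetP/idP => [[u + ->]|eQ]; first by rewrite inE.
have eG : e \in gedges (complete_geometric_graph P) by rewrite inE (Q2 e eQ).
by exists (Sub e eG); rewrite ?inE.
Qed.

(** Passes to vertices of the hypergraph; members of [T] that are not pairs are dropped. *)
Definition edge_trace (T : {set {set P}}) : {set hvertex treeH} := [set u | val u \in T].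

Lemma edge_trace_transversal (T : {set {set P}}) :
  (forall Q, connected_edges Q -> noncrossing (@crossing R P) Q ->
    (forall e, e \in Q -> #|e| = 2) -> 2 <= #|Q :&: T|) ->
  double_transversal (edge_trace T).
Proof.
move=> dT; apply/forall_inP => e; rewrite inE => /asboolP[tree plane].
have := dT _ (spanning_tree_connected tree) plane.
move=> /(_ _)/leq_trans; apply.
  by move=> _ /imsetP[u _ ->]; exact: edge_card.
rewrite -[X in _ <= X](card_imset _ val_inj); apply: subset_leq_card.
apply/fintype.subsetP => _ /setIP[/imsetP[u ue ->] uT].
by apply: imset_f; rewrite !inE ue.
Qed.

Lemma card_edge_trace (T : {set {set P}}) : #|edge_trace T| <= #|T|.
Proof.
rewrite -[X in X <= _](card_imset _ val_inj); apply: subset_leq_card.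
by apply/fintype.subsetP => _ /imsetP[u + ->]; rewrite inE.
Qed.

Section Selection.
Variables (k : nat) (c : {ffun hvertex treeH -> 'I_k}).

(* s selects one edge of each colour when it is a right inverse of c. *)
Definition unselected (s : 'I_k -> hvertex treeH) : {set {set P}} :=
  [set val u | u in ~: [set s i | i in 'I_k]].

Lemma card_unselected s : cancel s c -> #|unselected s| + k = nu treeH.
Proof.
move=> sK; rewrite card_imset; last exact: val_inj.
rewrite -[X in _ + X](card_ord k) -(card_imset _ (can_inj sK)) addnC.
by rewrite cardsC.
Qed.

Lemma mem_unselected s u : (val u \in unselected s) = (u \notin [set s i | i in 'I_k]).
Proof. by rewrite (mem_imset _ _ val_inj) finset.in_setC. Qed.

(** Let [d] represent its own colour; the former representative of that colour becomes
    unselected. *)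
Lemma unselected_exchange s d : cancel s c -> d \in unselected s ->
  exists f s', [/\ f \notin unselected s, cancel s' c &
    unselected s' = f |: (unselected s :\ d)].
Proof.
move=> sK /imsetP[u]; rewrite finset.in_setC => us ->.
pose s' i := if i == c u then u else s i.
exists (val (s (c u))), s'; split.
- by rewrite mem_unselected negbK imset_f.
- by move=> i; rewrite /s'; case: eqVneq => [->|].
have inj := val_inj : injective (val : hvertex treeH -> {set P}).
have nsu : s (c u) != u by apply: contraNneq us => <-; exact: imset_f.
apply/setP => e; rewrite !inE; apply/imsetP/idP => [[v + ->]|].
  rewrite finset.in_setC => vs'; rewrite (inj_eq inj) mem_unselected (inj_eq inj).
  have [//|vsu /=] := eqVneq v (s (c u)).
  apply/andP; split.
    by apply: contraNneq vs' => ->; apply/imsetP; exists (c u); rewrite /s' ?eqxx.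
  apply: contraNN vs' => /imsetP[i _ vE]; apply/imsetP; exists i => //.
  by rewrite /s'; case: eqVneq vE => [->|//] /eqP; rewrite (negPf vsu).
move=> /orP[/eqP->|/andP[eu /imsetP[v vs eE]]].
  exists (s (c u)) => //; rewrite finset.in_setC; apply/imsetP => -[i _].
  rewrite /s'; case: eqVneq => [_ /eqP|ne /(can_inj sK) e']; first by rewrite (negPf nsu).
  by rewrite e' eqxx in ne.
exists v => //; rewrite finset.in_setC; rewrite finset.in_setC in vs.
apply: contraNN vs => /imsetP[i _]; rewrite /s'; case: eqVneq => [_ vE|_ ->].
  by rewrite eE vE eqxx in eu.
exact: imset_f.
Qed.

Lemma avoidable_heterochromatic s : cancel s c ->
  avoidable (@crossing R P) [set: P] (unselected s) ->
  exists2 e, e \in hedges treeH & heterochromatic c e.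
Proof.
move=> sK /avoidable_tree[Q treeQ Q2].
have [T TH TE] := tree_hyperedge treeQ (fun e eQ => (Q2 e eQ).1).
exists T => //.
have sel u : u \in T -> exists i, u = s i.
  rewrite TE => /Q2[_]; rewrite mem_unselected negbK => /imsetP[i _ ->].
  by exists i.
by move=> u v /sel[i ->] /sel[j ->]; rewrite !sK => ->.
Qed.

End Selection.

Lemma plane_tree_exists : general_position P -> forall a : P, extreme (@ccw R P) a ->
  2 < #|{: P}| -> exists e, e \in hedges treeH.
Proof.
move=> gen a ea P2.
pose D : {set {set P}} := finset.set0.
have [|Q treeQ Q2] := @avoidable_tree D.
  have sub0 : [set e in D | e \subset [set: P]] = D by apply/setP => e; rewrite !inE.
  apply: (sparse_avoidable (@ccw_rot R P) (ccw_swap gen) (@ccw_same R P)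
    (@crossing_sym R P) (@ccw_separated R P) (share_not_crossing gen)
    (finset.in_setT a) ea).
  by rewrite sub0 cards0 cardsT (ltn_trans _ P2).
have [T TH _] := tree_hyperedge treeQ (fun e eQ => (Q2 e eQ).1).
by exists T.
Qed.

(** * The value of the heterochromatic number *)

Lemma forces_treeH (T : {set {set P}}) :
  double_transversal (edge_trace T) ->
  (forall k (c : {ffun hvertex treeH -> 'I_k}) s, cancel s c ->
    (forall s, cancel s c -> #|unselected s| + 2 <= #|T|) ->
    exists2 s, cancel s c & avoidable (@crossing R P) [set: P] (unselected s)) ->
  forces_heterochromatic treeH (nu treeH - tau treeH + 2).
Proof.
move=> dT avoid c cS.
have [s sK] : exists s : 'I_(nu treeH - tau treeH + 2) -> hvertex treeH,
    forall i, c (s i) = i by exact: fin_all_exists cS.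
have [|s' s'K av] := avoid _ c s sK; last exact: avoidable_heterochromatic av.
move=> s' s'K; apply: leq_trans (card_edge_trace T).
apply: leq_trans (tau_le dT); have := card_unselected s'K.
(* This gives tau <= nu, so the truncated subtraction is exact and tau - 2 edges are unselected. *)
have := leq_trans (tau_le dT) (max_card (mem (edge_trace T))).
by rewrite -/(nu treeH); lia.
Qed.

Lemma hc_treeH : general_position P -> 2 < #|{: P}| -> interior_number P <= 1 ->
  hc treeH = nu treeH - tau treeH + 2.
Proof.
move=> gen P2 i1.
have rot := @ccw_rot R P; have swap := ccw_swap gen; have same := @ccw_same R P.
have pl := @ccw_pluecker R P; have csym := @crossing_sym R P.
have cI := @crossing_intro R P; have sep := @ccw_separated R P.
have share := share_not_crossing gen.
have [all_ext|[p np ext]] := at_most_one_interior gen i1.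
  have dT : double_transversal (edge_trace (hull_edges (@ccw R P))).
    apply: edge_trace_transversal => Q conn plane Q2.
    exact: (hull_edges_double_transversal rot swap same cI conn plane all_ext P2 Q2).
  have [a _] : exists a : P, a \in {: P} by apply/card_gt0P; rewrite (ltn_trans _ P2).
  have [e0 e0H] := plane_tree_exists gen (all_ext a) P2.
  apply: (hcE e0H dT); apply: forces_treeH dT _ => k c s sK small.
  exists s => //; apply: (sparse_avoidable rot swap same csym sep share
    (finset.in_setT a) (all_ext a)).
  (* The unselected edges number at most |P| - 2, since there are at most |P| hull edges; this is
     the sparse case. *)
  rewrite cardsT; apply: leq_trans (max_card [pred a | extreme (@ccw R P) a]).
  apply: leq_trans (card_hull_edges _); apply: leq_trans (small s sK).
  rewrite addn2 addn1 !ltnS; apply: subset_leq_card.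
  by apply/fintype.subsetP => e; rewrite inE => /andP[].
have [s0 [t0 anti]] := antipodal_exists rot swap same pl np.
have dT : double_transversal (edge_trace (pierced_hull_edges (@ccw R P) p s0 t0)).
  apply: edge_trace_transversal => Q conn plane _.
  exact: (pierced_hull_edges_double_transversal rot swap same pl cI ext anti conn plane).
have [a ea] : exists a : P, extreme (@ccw R P) a.
  have /card_gt1P[x [y [_ _ xy]]] := ltnW P2.
  have [xp|xp] := eqVneq x p; last by exists x; exact: ext.
  by exists y; apply: ext; rewrite -xp eq_sym.
have [e0 e0H] := plane_tree_exists gen ea P2.
apply: (hcE e0H dT); apply: forces_treeH dT _ => k c s sK small.
pose family D := exists2 s, cancel s c & D = unselected s.
have [||||_ [s' s'K ->] av] := @family_avoidable _ _ _ rot swap same pl csym sep share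
  p ext np family _ _ _ (unselected s); last by exists s'.
- by move=> _ [s' _ ->] _ /imsetP[u _ ->]; exact: edge_card.
(* The transversal has at most |P| + 1 elements, so at most |P| - 1 edges are unselected. *)
- move=> _ [s' s'K ->]; have := small s' s'K.
  by move=> /leq_trans/(_ (card_pierced_hull_edges s0 t0 np)); rewrite addn1 addn2 ltnS.
- move=> D d [s' s'K ->] ds'.
  have [f [s'' [fs' s''K sE]]] := unselected_exchange s'K ds'.
  by exists f => //; exists s''.
- by exists s.
Qed.

End PlaneTrees.

Theorem theorem5 (R : realType) (n : nat) (P : {fset 'rV[R]_2}) :
  (#|` P| = n)%N ->
  (3 <= n)%N ->
  general_position P ->
  (interior_number P <= 1)%N ->
  let H := tree_hypergraph (complete_geometric_graph P) in
  (hc H = nu H - tau H + 2)%N.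
Proof. by move=> <-; rewrite cardfE => P3 gen i1; exact: hc_treeH. Qed.
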